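(* Let $\mathscr{H},\mathscr{K}$ be Hilbert spaces and let $A,B\in\mathbb{B}(\mathscr{H})$ be such that $0<b_1I\le A\le a_1I$ and $0<b_2I\le B\le a_2I$ for some scalars $0<b_i<a_i$, $i=1,2$. Let $\Phi:\mathbb{B}(\mathscr{H})\to\mathbb{B}(\mathscr{K})$ be a positive linear map. Then for any operator mean $\sigma$ with the representing function $f$, the following double inequality holds: $$\omega^{1-\alpha}\left(\Phi(A)\#_\alpha\Phi(B)\right)\le(\omega\Phi(A))\nabla_\alpha\Phi(B)\le\frac{\alpha}{\mu}\Phi(A\sigma B),$$ where $$\mu=\frac{a_1b_1\left(f(b_2a_1^{-1})-f(a_2b_1^{-1})\right)}{b_1b_2-a_1a_2},\qquad \nu=\frac{a_1a_2f(b_2a_1^{-1})-b_1b_2f(a_2b_1^{-1})}{a_1a_2-b_1b_2},\qquad \omega=\frac{\alpha\nu}{(1-\alpha)\mu}$$ and $\alpha\in(0,1)$.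
   Context: $\mathbb{B}(\mathscr{H})$ is the algebra of bounded linear operators on $\mathscr{H}$, and $I$ is the identity. A selfadjoint operator $X$ is positive ($X\ge0$) if $\langle X\xi,\xi\rangle\ge0$ for all $\xi$, and strictly positive ($X>0$) if $\langle X\xi,\xi\rangle>0$ for all $\xi\ne0$; $X\le Y$ means $Y-X\ge0$. A linear map is positive if it maps positive operators to positive operators. An operator mean $\sigma$ (in the sense of Kubo and Ando) is a binary operation on the set of strictly positive operators such that (i) $I\sigma I=I$; (ii) $C^*(A\sigma B)C\le(C^*AC)\sigma(C^*BC)$; (iii) $A_n\downarrow A$ and $B_n\downarrow B$ imply $A_n\sigma B_n\downarrow A\sigma B$ (decreasing sequences converging in the strong operator topology); (iv) $A\le B$ and $C\le D$ imply $A\sigma C\le B\sigma D$. Operator means correspond bijectively to positive operator monotone functions $f$ on $(0,\infty)$ with $f(1)=1$ (the representing function of $\sigma$), via $f(t)I=I\sigma(tI)$, $t>0$, and $A\sigma B=A^{1/2}f(A^{-1/2}BA^{-1/2})A^{1/2}$ for strictly positive $A,B$. Here a continuous real-valued $f$ is operator monotone if $A\ge B$ implies $f(A)\ge f(B)$ for all selfadjoint $A,B$ with spectra in its domain. The definition of $A\sigma B$ is extended to positive operators by a limit argument using $A+\varepsilon I$ and $B+\varepsilon I$. For $0\le\alpha\le1$, $\nabla_\alpha$ (weighted arithmetic mean) and $\#_\alpha$ (weighted geometric mean) are the operator means with representing functions $(1-\alpha)+\alpha t$ and $t^\alpha$ respectively; thus $X\nabla_\alpha Y=(1-\alpha)X+\alpha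 Y$. *)

(* Defs.v *)
From HB Require Import structures.
From mathcomp Require Import all_boot all_order all_algebra complex.
From mathcomp Require Import all_classical all_reals all_analysis.

Set Implicit Arguments.
Unset Strict Implicit.
Unset Printing Implicit Defensive.

Import Order.TTheory GRing.Theory Num.Theory.
Import numFieldNormedType.Exports.

Local Open Scope classical_set_scope.
Local Open Scope ring_scope.
Local Open Scope complex_scope.

(* The inner product is linear in its first argument. *)
HB.mixin Record NormedModule_isHilbert (R : realType) (H : Type)
    of CompleteNormedModule R[i] H := {
  hform : {dot H for @Num.conj R[i]} ;
  hnormE : forall x : H, `|x| ^+ 2 = hform x x
}.

#[short(type="hilbertType")]
HB.structure Definition Hilbert (R : realType) :=
  {H of NormedModule_isHilbert R H & CompleteNormedModule R[i] H}.

Definition inner {R : realType} {H : hilbertType R} (x y : H) : R[i] :=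
  hform x y.

Notation "⟪ x , y ⟫" := (inner x y)
  (at level 0, x at level 99, y at level 99, format "⟪ x ,  y ⟫") : ring_scope.

Section BoundedOperators.
Context {R : realType}.

Definition bounded_linear (H : hilbertType R) : {pred H -> H} :=
  mem [set f : H -> H |
    linear f /\ exists M : R[i], forall x, `|f x| <= M * `|x|].

Lemma bounded_linearP (H : hilbertType R) (f : H -> H) :
  reflect (linear f /\ exists M : R[i], forall x, `|f x| <= M * `|x|)
          (f \in @bounded_linear H).
Proof. by apply: (iffP idP) => [/set_mem|/mem_set]. Qed.

Lemma bounded_linear_submod (H : hilbertType R) :
  submod_closed (@bounded_linear H).
Proof.
split=> [|a f g /bounded_linearP[lf [M fM]] /bounded_linearP[lg [N gN]]].
  apply/bounded_linearP; split=> [k x y|]; first by rewrite scaler0 addr0.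
  by exists 0 => x; rewrite normr0 mul0r.
apply/bounded_linearP; split=> [k x y|].
  rewrite -[LHS]/(a *: f (k *: x + y) + g (k *: x + y)).
  rewrite -[RHS]/(k *: (a *: f x + g x) + (a *: f y + g y)).
  by rewrite lf lg !scalerDr addrACA !scalerA mulrC.
exists (`|a| * M + N) => x.
rewrite mulrDl (le_trans (ler_normD _ _))// lerD//.
by rewrite normrZ -mulrA ler_wpM2l.
Qed.

HB.instance Definition _ (H : hilbertType R) :=
  GRing.isSubmodClosed.Build R[i] (H -> H) (@bounded_linear H)
    (bounded_linear_submod H).

Record boundedOp (H : hilbertType R) := BoundedOp {
  bop_fun :> H -> H ;
  bop_subproof : bop_fun \in @bounded_linear H
}.

HB.instance Definition _ (H : hilbertType R) :=
  [isSub of boundedOp H for @bop_fun H].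
HB.instance Definition _ (H : hilbertType R) :=
  [Choice of boundedOp H by <:].
HB.instance Definition _ (H : hilbertType R) :=
  [SubChoice_isSubLmodule of boundedOp H by <:].

Lemma idop_subproof (H : hilbertType R) : (id : H -> H) \in @bounded_linear H.
Proof.
by apply/bounded_linearP; split=> //; exists 1 => x; rewrite mul1r.
Qed.

Definition idop (H : hilbertType R) : boundedOp H :=
  BoundedOp (idop_subproof H).

Lemma mulop_subproof (H : hilbertType R) (A B : boundedOp H) :
  (A \o B) \in @bounded_linear H.
Proof.
case: A B => [f Pf] [g Pg].
have /bounded_linearP[lf [M fM]] := Pf.
have /bounded_linearP[lg [N gN]] := Pg.
apply/bounded_linearP; split=> [k x y /=|]; first by rewrite lg lf.
exists (`|M| * N) => x /=; rewrite (le_trans (fM _))//.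
case: (eqVneq (g x) 0) => [->|gx0].
  rewrite normr0 mulr0 -mulrA mulr_ge0//.
  exact: le_trans (gN x).
have M0 : 0 <= M.
  have := le_trans (normr_ge0 _) (fM (g x)).
  by rewrite pmulr_lge0// normr_gt0.
by rewrite ger0_norm// -mulrA ler_wpM2l.
Qed.

Definition mulop (H : hilbertType R) (A B : boundedOp H) : boundedOp H :=
  BoundedOp (mulop_subproof A B).

End BoundedOperators.

Notation "''B' ( H )" := (boundedOp H) (at level 8, format "''B' ( H )")
  : type_scope.
Notation "A '∘' B" := (mulop A B) (at level 40, left associativity)
  : ring_scope.

Section OperatorOrder.
Context {R : realType} {H : hilbertType R}.
Implicit Types A B C X : 'B(H).

Definition is_adjoint A B : Prop := forall x y : H, ⟪ A x, y ⟫ = ⟪ x, B y ⟫.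

Definition selfadjoint A : Prop := is_adjoint A A.

(* [0 <= z] in [R[i]] means that [z] is real and nonnegative. *)
Definition posop A : Prop :=
  selfadjoint A /\ forall x : H, 0 <= ⟪ A x, x ⟫.

Definition sposop A : Prop :=
  selfadjoint A /\ forall x : H, x != 0 -> 0 < ⟪ A x, x ⟫.

Definition leop A B : Prop := posop (B - A).

Definition realop (r : R) : 'B(H) := r%:C *: idop H.

Definition sot_cvg (A_ : nat -> 'B(H)) A : Prop :=
  forall x : H, A_ n x @[n --> \oo] --> A x.

Definition sot_decr (A_ : nat -> 'B(H)) A : Prop :=
  (forall n, leop (A_ n.+1) (A_ n)) /\ sot_cvg A_ A.

End OperatorOrder.

Notation "A <=op B" := (leop A B) (at level 70, no associativity) : ring_scope.

Section FunctionalCalculus.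
Context {R : realType} {H : hilbertType R}.
Implicit Types A X : 'B(H).

Definition invertibleop A : Prop :=
  exists B : 'B(H), A ∘ B = idop H /\ B ∘ A = idop H.

Definition spectrum A : set R[i] :=
  [set z | ~ invertibleop (A - z *: idop H)].

Definition powop A (n : nat) : 'B(H) := iter n (mulop A) (idop H).

Definition polyop (p : {poly R}) A : 'B(H) :=
  \sum_(k < size p) (p`_k)%:C *: powop A k.

(* [X = f(A)] for selfadjoint [A] and [f] continuous on the spectrum of [A]:
   [X] is the norm limit of [p(A)] for polynomials [p] tending to [f] uniformly
   on the spectrum. *)
Definition is_fun_calculus (f : R -> R) A X : Prop :=
  forall e : R, 0 < e -> exists p : {poly R},
    (forall t : R, spectrum A t%:C -> `|f t - p.[t]| <= e) /\
    (forall x : H, `|(X - polyop p A) x| <= e%:C * `|x|).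

End FunctionalCalculus.

Definition operator_monotone {R : realType} (f : R -> R) : Prop :=
  (forall t : R, 0 < t -> {for t, continuous f}) /\
  forall (H : hilbertType R) (A B fA fB : 'B(H)),
    selfadjoint A -> selfadjoint B ->
    spectrum A `<=` [set t%:C | t in [set t : R | 0 < t]] ->
    spectrum B `<=` [set t%:C | t in [set t : R | 0 < t]] ->
    is_fun_calculus f A fA -> is_fun_calculus f B fB ->
    B <=op A -> fB <=op fA.

(* An operation on the strictly positive operators is encoded by a total
   function whose values elsewhere are irrelevant. The values are only required
   to be positive: in infinite dimension the harmonic mean of two (injective,
   not necessarily invertible) strictly positive operators can be zero.
   In the transformer inequality [Cs] is the adjoint of [C], and the right-hand
   side is defined when [Cs A C] and [Cs B C] are strictly positive. *)
Record operator_mean {R : realType} {H : hilbertType R}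
    (sigma : 'B(H) -> 'B(H) -> 'B(H)) : Prop := OperatorMean {
  mean_pos : forall A B, sposop A -> sposop B -> posop (sigma A B) ;
  mean_id : sigma (idop H) (idop H) = idop H ;
  mean_transformer : forall A B C Cs, sposop A -> sposop B ->
    is_adjoint C Cs -> sposop (Cs ∘ A ∘ C) -> sposop (Cs ∘ B ∘ C) ->
    Cs ∘ sigma A B ∘ C <=op sigma (Cs ∘ A ∘ C) (Cs ∘ B ∘ C) ;
  mean_decr : forall (A_ B_ : nat -> 'B(H)) A B,
    (forall n, sposop (A_ n)) -> (forall n, sposop (B_ n)) ->
    sposop A -> sposop B -> sot_decr A_ A -> sot_decr B_ B ->
    sot_decr (fun n => sigma (A_ n) (B_ n)) (sigma A B) ;
  mean_mono : forall A B C D,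
    sposop A -> sposop B -> sposop C -> sposop D ->
    A <=op B -> C <=op D -> sigma A C <=op sigma B D
}.

(* Operator monotonicity of [f] has to be stated: for finite-dimensional [H] it
   does not follow from [repr_mean] and the axioms of an operator mean. *)
Record representing_function {R : realType} {H : hilbertType R}
    (sigma : 'B(H) -> 'B(H) -> 'B(H)) (f : R -> R) : Prop :=
  RepresentingFunction {
  repr_pos : forall t : R, 0 < t -> 0 < f t ;
  repr_monotone : operator_monotone f ;
  repr_one : f 1 = 1 ;
  repr_mean : forall t : R, 0 < t -> realop (f t) = sigma (idop H) (realop t)
}.

(* Extension to positive operators: the strong limit of
   [sigma (A + e I) (B + e I)] as [e] decreases to 0. By [mean_decr] and
   [mean_mono] it agrees with [sigma A B] for strictly positive [A], [B]. *)
Definition ext_mean {R : realType} {H : hilbertType R}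
    (sigma : 'B(H) -> 'B(H) -> 'B(H)) (A B : 'B(H)) : 'B(H) :=
  xget 0 [set X : 'B(H) | forall x : H,
    sigma (A + realop e) (B + realop e) x @[e --> (0 : R)^'+] --> X x].

Definition warith {R : realType} {H : hilbertType R} (alpha : R)
    (X Y : 'B(H)) : 'B(H) := (1 - alpha)%:C *: X + alpha%:C *: Y.

Definition geometric_mean {R : realType} {H : hilbertType R} (alpha : R)
    (tau : 'B(H) -> 'B(H) -> 'B(H)) : Prop :=
  operator_mean tau /\ representing_function tau (fun t => t `^ alpha).

Definition positive_map {R : realType} {H K : hilbertType R}
    (Phi : 'B(H) -> 'B(K)) : Prop := forall X, posop X -> posop (Phi X).

(* Main.v *)
Require Import Defs.
From HB Require Import structures.
From mathcomp Require Import all_boot all_order all_algebra complex.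
From mathcomp Require Import all_classical all_reals all_analysis.
From mathcomp Require Import ring lra.
Set Implicit Arguments.
Unset Strict Implicit.
Unset Printing Implicit Defensive.

Import Order.TTheory GRing.Theory Num.Theory.
Import numFieldNormedType.Exports.

Local Open Scope classical_set_scope.
Local Open Scope ring_scope.
Local Open Scope complex_scope.

(** Write [m = b2 / a1] and [M = a2 / b1], so that [m A <= B <= M A]. Then [mu] and
    [nu] are the slope and the intercept of the chord of [f] over [[m, M]].

    Second inequality. An operator monotone function is concave, hence
    [nu + mu t <= f t] on [[m, M]], and the mean inherits this bound:
    [nu A + mu B <= sigma A B] ([mean_ge_line]). Applying [Phi] and multiplying by
    [alpha / mu] gives the claim, since [(1 - alpha) omega = alpha nu / mu]. First
    inequality. Young's inequality bounds [omega^(1 - alpha) t^alpha] by the affine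
    function [(1 - alpha) omega + alpha t], the geometric mean inherits this bound
    ([mean_le_line]), and the limit that defines the extended mean preserves it.
    For [omega >= 0] one needs [nu >= 0], which holds because a positive concave
    function lies above the line through the origin and any later point of its
    graph.

    Everything rests on the principle that an affine bound for the representing
    function is a bound for the mean. Congruence by [A^(1/2)] reduces it to
    [S = sigma 1 T]. As [f] is tied to [sigma] on scalars only, [S] has to be
    identified from the axioms. It commutes with [T], because conjugation by a
    unitary that commutes with [T] fixes [S] and [T] is a combination of such
    unitaries ([mean_commute]). On a positive operator [N] that commutes with [T]
    and is concentrated where [l <= T <= r], monotonicity and the transformer
    inequality give [f l N <= S N <= f r N] ([local_lower], [local_upper]). If the
    asserted inequality failed, the part of space where it fails by a fixed amount
    could be bisected along [T] into arbitrarily thin nonzero pieces, on which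
    these bounds contradict the scalar inequality ([posop_local]). Positive and
    negative parts of operators, built from square roots, replace spectral
    projections throughout.

    Concavity of [f] is a statement about two-by-two matrices
    ([operator_monotone_concave]). Since the given spaces may have dimension one,
    it is proved in the Hilbert space [ell2 R 2], constructed for this purpose. *)

(** * Inner product and norm *)

Section Inner.
Context {R : realType} {H : hilbertType R}.
Implicit Types (x y z : H) (k : R[i]).

Lemma innerC x y : ⟪ x, y ⟫ = conjc ⟪ y, x ⟫.
Proof. by rewrite /inner hermC/= expr0 mul1r. Qed.

Lemma innerDl x y z : ⟪ x + y, z ⟫ = ⟪ x, z ⟫ + ⟪ y, z ⟫.
Proof. exact: linearDl. Qed.

Lemma innerZl k x z : ⟪ k *: x, z ⟫ = k * ⟪ x, z ⟫.
Proof. exact: linearZl_LR. Qed.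

Lemma innerDr x y z : ⟪ z, x + y ⟫ = ⟪ z, x ⟫ + ⟪ z, y ⟫.
Proof. exact: linearDr. Qed.

Lemma innerZr k x z : ⟪ z, k *: x ⟫ = conjc k * ⟪ z, x ⟫.
Proof. exact: linearZr_LR. Qed.

Lemma innerNl x z : ⟪ - x, z ⟫ = - ⟪ x, z ⟫.
Proof. exact: linearNl. Qed.

Lemma innerNr x z : ⟪ z, - x ⟫ = - ⟪ z, x ⟫.
Proof. exact: linearNr. Qed.

Lemma inner0l z : ⟪ 0, z ⟫ = 0.
Proof. exact: linear0l. Qed.

Lemma inner0r z : ⟪ z, 0 ⟫ = 0.
Proof. exact: linear0r. Qed.

Lemma innerxx x : ⟪ x, x ⟫ = `|x| ^+ 2.
Proof. by rewrite hnormE. Qed.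

(** The norm of [H] takes its values in [R[i]]; estimates are carried out with
    its real part. *)
Definition nrm x : R := complex.Re `|x|.

Lemma nrmE x : `|x| = (nrm x)%:C.
Proof. by rewrite RRe_real// ger0_real. Qed.

Lemma nrm_ge0 x : 0 <= nrm x.
Proof. by rewrite -ler0c -nrmE. Qed.

Lemma nrm_sqr x : ⟪ x, x ⟫ = (nrm x ^+ 2)%:C.
Proof. by rewrite innerxx nrmE -rmorphXn. Qed.

Lemma nrm_eq0 x : nrm x = 0 -> x = 0.
Proof. by move=> x0; apply/eqP; rewrite -normr_eq0 nrmE x0. Qed.

Lemma nrm0 : nrm 0 = 0.
Proof. by rewrite /nrm normr0. Qed.

Lemma nrmD x y : nrm (x + y) <= nrm x + nrm y.
Proof. by rewrite -lecR rmorphD/= -!nrmE ler_normD. Qed.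

Lemma nrmN x : nrm (- x) = nrm x.
Proof. by rewrite /nrm normrN. Qed.

Lemma nrmB x y : nrm (x - y) <= nrm x + nrm y.
Proof. by rewrite -(nrmN y) nrmD. Qed.

Lemma nrmZ (r : R) x : nrm (r%:C *: x) = `|r| * nrm x.
Proof.
apply: complexI; rewrite rmorphM/= -!nrmE normrZ; congr (_ * _).
by rewrite normc_def/= expr0n addr0 sqrtr_sqr.
Qed.

Lemma nrm_cvg (T : Type) (F : set_system T) {FF : Filter F} (u : T -> H) y :
  (forall e : R, 0 < e -> \forall n \near F, nrm (u n - y) <= e) -> u @ F --> y.
Proof.
move=> h; apply/cvgrPdist_le => /= -[a b].
rewrite ltcE/= => /andP[/eqP -> a0].
move: (h _ a0); apply: filterS => n.
by rewrite distrC nrmE lecR.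
Qed.

Lemma cvg_nrm (T : Type) (F : set_system T) {FF : Filter F} (u : T -> H) y :
  u @ F --> y -> forall e : R, 0 < e -> \forall n \near F, nrm (u n - y) <= e.
Proof.
move=> uy e e0; have e0c : 0 < e%:C by rewrite ltcR.
move/cvgrPdist_le : uy => /(_ _ e0c); apply: filterS => n.
by rewrite distrC nrmE lecR.
Qed.

(** Cauchy's criterion in the form that successive approximation produces:
    increments dominated by those of a bounded nondecreasing real sequence. *)
Lemma dominated_cvg (u : nat -> H) (y : nat -> R) (M c : R) :
  0 <= c -> (forall n, nrm (u n.+1 - u n) <= c * (y n.+1 - y n)) ->
  (forall n, y n <= M) -> (forall n, y n <= y n.+1) ->
  exists l : H, u @ \oo --> l.
Proof.
move=> c0 uy yM yS.
have yndec : nondecreasing_seq y by apply/nondecreasing_seqP.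
have ycvg : cvgn y.
  by apply: nondecreasing_is_cvgn => //; exists M => _ [n _ <-].
have hm m n : (m <= n)%N -> nrm (u n - u m) <= c * (y n - y m).
  move=> /subnK <-; elim: (n - m)%N => [|k IH].
    by rewrite add0n !subrr nrm0 mulr0.
  rewrite addSn -(subrKA (u (k + m)%N)) (le_trans (nrmD _ _))//.
  have -> : y (k + m).+1 - y m = (y (k + m).+1 - y (k + m)%N) + (y (k + m)%N - y m) by ring.
  by rewrite mulrDr lerD.
suff : cvgn u by exists (limn u).
apply: cauchy_cvg; apply/cauchy_exP => -[e b]; rewrite ltcE/= => /andP[/eqP -> e0].
pose d := e / (2 * (c + 1)).
have d0 : 0 < d by rewrite /d divr_gt0//; lra.
have [n0 _ hn0] : \forall n \near \oo, `|limn y - y n| <= d.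
  by move/cvgrPdist_le : ycvg => /(_ _ d0).
exists (u n0); exists n0 => //= n n0n; rewrite -ball_normE/= distrC nrmE ltcR.
apply: (le_lt_trans (hm _ _ n0n)).
have h1 : y n - y n0 <= d.
  have := hn0 n0 (leqnn _); rewrite /= ler_norml => /andP[_].
  have := nondecreasing_cvgn_le yndec ycvg n; lra.
apply: (@le_lt_trans _ _ (c * d)); first by rewrite ler_wpM2l.
have -> : e = 2 * (c + 1) * d by rewrite /d; field; lra.
have : 0 <= c * d by rewrite mulr_ge0// ltW.
lra.
Qed.

End Inner.

(** * Bounded operators and their quadratic forms *)

Arguments bop_fun : simpl never.

Section OperatorRing.
Context {R : realType} {H : hilbertType R}.
Implicit Types (A B C : 'B(H)) (x y : H).

Lemma opP A B : A =1 B -> A = B.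
Proof. by move=> AB; apply: val_inj; apply/funext. Qed.

Lemma op_linear A : linear A.
Proof. by have /bounded_linearP[] := bop_subproof A. Qed.

Lemma opD A x y : A (x + y) = A x + A y.
Proof. by have := op_linear A 1 x y; rewrite !scale1r. Qed.

Lemma op0 A : A 0 = 0.
Proof. by apply: (addrI (A 0)); rewrite -opD !addr0. Qed.

Lemma opZ A k x : A (k *: x) = k *: A x.
Proof. by have := op_linear A k x 0; rewrite op0 !addr0. Qed.

Lemma opN A x : A (- x) = - A x.
Proof. by rewrite -scaleN1r opZ scaleN1r. Qed.

Lemma opB A x y : A (x - y) = A x - A y.
Proof. by rewrite opD opN. Qed.

Lemma mulopA : associative (@mulop R H). Proof. by move=> A B C; apply: opP. Qed.
Lemma mul1op : left_id (idop H) (@mulop R H). Proof. by move=> A; apply: opP. Qed.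
Lemma mulop1 : right_id (idop H) (@mulop R H). Proof. by move=> A; apply: opP. Qed.
Lemma mulopDl : left_distributive (@mulop R H) +%R.
Proof. by move=> A B C; apply: opP. Qed.
Lemma mulopDr : right_distributive (@mulop R H) +%R.
Proof. by move=> A B C; apply: opP => x; exact: opD. Qed.

End OperatorRing.

(** The trivial space is allowed, whence a ring in which [0 = 1] may hold. *)
HB.instance Definition _ (R : realType) (H : hilbertType R) :=
  GRing.Zmodule_isPzRing.Build 'B(H)
    (@mulopA R H) (@mul1op R H) (@mulop1 R H) (@mulopDl R H) (@mulopDr R H).

Notation commute := GRing.comm.
Notation "r ∙ A" := (r%:C *: A) (at level 40, left associativity) : ring_scope.

Section QuadraticForm.
Context {R : realType} {H : hilbertType R}.
Implicit Types (A B C X Y : 'B(H)) (x y : H) (r s : R).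

Lemma addopE A B x : (A + B) x = A x + B x. Proof. by []. Qed.
Lemma oppopE A x : (- A) x = - A x. Proof. by []. Qed.
Lemma scaleopE k A x : (k *: A) x = k *: A x. Proof. by []. Qed.
Lemma mulopE A B x : (A * B) x = A (B x). Proof. by []. Qed.
Lemma oneopE x : (1 : 'B(H)) x = x. Proof. by []. Qed.

Lemma scaleopAl k A B : k *: A * B = k *: (A * B).
Proof. exact: opP. Qed.

Lemma scaleopAr k A B : A * (k *: B) = k *: (A * B).
Proof. by apply: opP => x; exact: opZ. Qed.

Lemma realopE r : realop r = r ∙ (1 : 'B(H)). Proof. by []. Qed.

Lemma commuteZ k A B : commute A B -> commute A (k *: B).
Proof. by rewrite /commute scaleopAl scaleopAr => ->. Qed.

Lemma commute_real A r : commute A (r ∙ (1 : 'B(H))).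
Proof. exact/commuteZ/commr1. Qed.

(** Taking the real part loses nothing on selfadjoint operators, and keeps the
    form real-valued for all others. *)
Definition q A x : R := complex.Re ⟪ A x, x ⟫.

Lemma qD A B x : q (A + B) x = q A x + q B x.
Proof. by rewrite /q addopE innerDl raddfD. Qed.

Lemma qN A x : q (- A) x = - q A x.
Proof. by rewrite /q oppopE innerNl raddfN. Qed.

Lemma qB A B x : q (A - B) x = q A x - q B x.
Proof. by rewrite qD qN. Qed.

Lemma qZ r A x : q (r ∙ A) x = r * q A x.
Proof.
rewrite /q scaleopE innerZl; case: (⟪ _, _ ⟫) => a b /=.
by rewrite mul0r subr0.
Qed.

Lemma q1 x : q 1 x = nrm x ^+ 2.
Proof. by rewrite /q oneopE nrm_sqr. Qed.

Lemma q0 x : q 0 x = 0.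
Proof. by rewrite /q inner0l. Qed.

Definition qE := (qD, qN, qZ, q1, q0).

Lemma q_real A x : selfadjoint A -> ⟪ A x, x ⟫ = (q A x)%:C.
Proof.
move=> sA; rewrite RRe_real// CrealE; apply/eqP.
by rewrite {2}sA; exact: esym (innerC _ _).
Qed.

Lemma saD A B : selfadjoint A -> selfadjoint B -> selfadjoint (A + B).
Proof. by move=> sA sB x y; rewrite !addopE innerDl innerDr sA sB. Qed.

Lemma saN A : selfadjoint A -> selfadjoint (- A).
Proof. by move=> sA x y; rewrite !oppopE innerNl innerNr sA. Qed.

Lemma saB A B : selfadjoint A -> selfadjoint B -> selfadjoint (A - B).
Proof. by move=> sA /saN; apply: saD. Qed.

Lemma saZ r A : selfadjoint A -> selfadjoint (r ∙ A).
Proof. by move=> sA x y; rewrite !scaleopE innerZl innerZr conjc_real sA. Qed.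

Lemma sa1 : selfadjoint (1 : 'B(H)).
Proof. by []. Qed.

Lemma sa0 : selfadjoint (0 : 'B(H)).
Proof. by move=> x y; rewrite inner0l inner0r. Qed.

Lemma sa_real r : selfadjoint (r ∙ (1 : 'B(H))).
Proof. exact/saZ/sa1. Qed.

Lemma saM A B : selfadjoint A -> selfadjoint B -> commute A B ->
  selfadjoint (A * B).
Proof. by move=> sA sB AB x y; rewrite {2}AB !mulopE sA sB. Qed.

Lemma sa_conj C A : selfadjoint C -> selfadjoint A -> selfadjoint (C * A * C).
Proof. by move=> sC sA x y; rewrite !mulopE sC sA sC. Qed.

Lemma sa_sqr A : selfadjoint A -> selfadjoint (A * A).
Proof. by move=> sA x y; rewrite !mulopE !sA. Qed.

Lemma q_conj C A x : selfadjoint C -> q (C * A * C) x = q A (C x).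
Proof. by move=> sC; rewrite /q !mulopE sC. Qed.

Lemma q_sqr C x : selfadjoint C -> q (C * C) x = nrm (C x) ^+ 2.
Proof. by move=> sC; rewrite -{1}(mulr1 C) q_conj// q1. Qed.

Lemma posopE A : posop A <-> selfadjoint A /\ forall x, 0 <= q A x.
Proof.
by split=> -[sA pA]; split=> // x; move: (pA x); rewrite q_real// ler0c.
Qed.

Lemma posop_sa A : posop A -> selfadjoint A. Proof. by case. Qed.

Lemma posop_q A x : posop A -> 0 <= q A x.
Proof. by move=> /posopE[_]. Qed.

Lemma leop_q A B x : A <=op B -> q A x <= q B x.
Proof. by move=> /(posop_q x); rewrite qB subr_ge0. Qed.

Lemma leopP A B : selfadjoint A -> selfadjoint B ->
  (forall x, q A x <= q B x) -> A <=op B.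
Proof.
move=> sA sB AB; apply/posopE; split; first exact: saB.
by move=> x; rewrite qB subr_ge0.
Qed.

Lemma leop_refl A : A <=op A.
Proof.
by rewrite /leop subrr; apply/posopE; split=> [|x]; [exact: sa0|rewrite q0].
Qed.

Lemma posop_conj C A : selfadjoint C -> posop A -> posop (C * A * C).
Proof.
move=> sC /posopE[sA pA]; apply/posopE; split; first exact: sa_conj.
by move=> x; rewrite q_conj.
Qed.

Lemma posop_sqr C : selfadjoint C -> posop (C * C).
Proof.
move=> sC; apply/posopE; split; first exact: sa_sqr.
by move=> x; rewrite q_sqr// sqr_ge0.
Qed.

Lemma leop_conj C A B : selfadjoint C -> A <=op B -> C * A * C <=op C * B * C.
Proof. by move=> sC /(posop_conj sC); rewrite mulrBr mulrBl. Qed.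

Lemma q_line A x y r : selfadjoint A ->
  q A (x + r%:C *: y) = q A x + 2 * r * complex.Re ⟪ A x, y ⟫ + r ^+ 2 * q A y.
Proof.
move=> sA; rewrite /q opD opZ !innerDl !innerDr !innerZl !innerZr conjc_real.
have -> : ⟪ A y, x ⟫ = conjc ⟪ A x, y ⟫ by rewrite -innerC sA.
case: ⟪ A x, y ⟫ => c d; case: ⟪ A y, y ⟫ => e f.
by case: ⟪ A x, x ⟫ => g j /=; ring.
Qed.

(** Only the real part of the form is needed, so that the discriminant of a
    real quadratic polynomial does the work. *)
Lemma pos_cauchy A x y : posop A ->
  complex.Re ⟪ A x, y ⟫ ^+ 2 <= q A x * q A y.
Proof.
move=> pA; set b := complex.Re _.
have h t : 0 <= q A x + 2 * t * b + t ^+ 2 * q A y.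
  by rewrite -q_line; [exact: posop_q|exact: posop_sa].
have := posop_q x pA; have := posop_q y pA.
move: h; move: (q A x) (q A y) b => u v b h; rewrite le_eqVlt => /predU1P[v0|v0] u0; first subst v.
  rewrite mulr0; case: (eqVneq b 0) => [->|b0]; first by rewrite expr0n.
  have := h (- (u + 1) / (2 * b)).
  have -> : u + 2 * (- (u + 1) / (2 * b)) * b + (- (u + 1) / (2 * b)) ^+ 2 * 0 = - 1.
    by field.
  by rewrite lerNr oppr0 ler10.
have := h (- b / v).
have -> : u + 2 * (- b / v) * b + (- b / v) ^+ 2 * v = u - b ^+ 2 / v.
  by field; rewrite gt_eqF.
by rewrite subr_ge0 ler_pdivrMr.
Qed.

Lemma Re_inner_le x y : complex.Re ⟪ x, y ⟫ <= nrm x * nrm y.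
Proof.
have p1 : posop (1 : 'B(H)).
  by apply/posopE; split=> [|z]; [exact: sa1|rewrite q1 sqr_ge0].
have := pos_cauchy x y p1; rewrite !q1 oneopE -exprMn => h.
rewrite (le_trans (ler_norm _))// -(ler_pXn2r (ltn0Sn 1)) ?nnegrE//; last first.
  by rewrite mulr_ge0 ?nrm_ge0.
by rewrite real_normK ?num_real.
Qed.

Lemma op_bounded A : exists2 M : R, 0 <= M & forall x, nrm (A x) <= M * nrm x.
Proof.
have /bounded_linearP[_ [M fM]] := bop_subproof A.
exists `|complex.Re M| => // x; have := fM x.
rewrite !nrmE; case: M fM => a b fM; rewrite lecE /= => /andP[_].
rewrite mulr0 subr0 => /le_trans; apply.
by rewrite ler_wpM2r ?nrm_ge0// ler_norm.
Qed.

Lemma op_cvg A (T : Type) (F : set_system T) {FF : Filter F} (u : T -> H) x :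
  u @ F --> x -> A (u n) @[n --> F] --> A x.
Proof.
move=> ux; have [M M0 AM] := op_bounded A.
apply: nrm_cvg => e e0.
have d0 : 0 < e / (M + 1) by rewrite divr_gt0//; lra.
have h0 : \forall n \near F, nrm (u n - x) <= e / (M + 1) by exact: cvg_nrm.
apply: filterS h0 => n h.
rewrite -opB (le_trans (AM _))//.
apply: (@le_trans _ _ ((M + 1) * (e / (M + 1)))); last first.
  by rewrite mulrC divfK//; lra.
apply: ler_pM => //; [exact: nrm_ge0|lra].
Qed.

Lemma q_ub A : exists2 M : R, 0 <= M & forall x, q A x <= M * nrm x ^+ 2.
Proof.
have [M M0 AM] := op_bounded A; exists M => // x.
rewrite (le_trans (Re_inner_le _ _))// expr2 mulrA.
by rewrite ler_wpM2r ?nrm_ge0.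
Qed.

Lemma pos_nrm_le A c : posop A -> 0 <= c -> (forall x, q A x <= c * nrm x ^+ 2) ->
  forall x, nrm (A x) <= c * nrm x.
Proof.
move=> pA c0 Ac x; have := pos_cauchy x (A x) pA.
rewrite nrm_sqr => h; have [->|n0] := eqVneq (nrm (A x)) 0.
  by rewrite mulr_ge0 ?nrm_ge0.
have nA : 0 < nrm (A x) by rewrite lt0r n0 nrm_ge0.
have : nrm (A x) ^+ 2 ^+ 2 <= (c * nrm x) ^+ 2 * nrm (A x) ^+ 2.
  rewrite (le_trans h)//.
  have := ler_pM (posop_q x pA) (posop_q (A x) pA) (Ac x) (Ac (A x)).
  by move/le_trans; apply; rewrite le_eqVlt; apply/orP; left; apply/eqP; ring.
rewrite expr2 ler_pM2r ?exprn_gt0//.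
by rewrite ler_pXn2r// ?nnegrE ?mulr_ge0 ?nrm_ge0.
Qed.

Lemma pos_eq0 A : posop A -> (forall x, q A x <= 0) -> A = 0.
Proof.
move=> pA A0; apply: opP => x; apply: nrm_eq0; apply/eqP.
rewrite eq_le nrm_ge0 andbT -(mul0r (nrm x)).
by apply: pos_nrm_le => // y; rewrite mul0r.
Qed.

Lemma leop_anti A B : A <=op B -> B <=op A -> A = B.
Proof.
move=> AB BA; apply/eqP; rewrite eq_sym -subr_eq0; apply/eqP/(pos_eq0 AB) => x.
by rewrite qB subr_le0 leop_q.
Qed.

End QuadraticForm.

(** * Strong limits, inverses and square roots *)

Section StrongLimits.
Context {R : realType} {H : hilbertType R}.
Implicit Types (A B C X Y : 'B(H)) (x y : H) (r s : R).

Lemma cvg_unique_nrm (T : Type) (F : set_system T) {FF : ProperFilter F}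
  (u : T -> H) x y : u @ F --> x -> u @ F --> y -> x = y.
Proof. exact: (cvg_unique (@norm_hausdorff R[i] H)). Qed.

Lemma cvg_Re_inner (T : Type) (F : set_system T) {FF : Filter F} (u : T -> H) x y :
  u @ F --> x -> complex.Re ⟪ u n, y ⟫ @[n --> F] --> complex.Re ⟪ x, y ⟫.
Proof.
move=> ux; apply/cvgrPdist_le => e e0.
have d0 : 0 < e / (nrm y + 1) by rewrite divr_gt0// ltr_wpDl ?nrm_ge0.
have h0 : \forall n \near F, nrm (u n - x) <= e / (nrm y + 1) by exact: cvg_nrm.
apply: filterS h0 => n h.
have {}h : nrm (u n - x) * nrm y <= e.
  have := nrm_ge0 y; have := nrm_ge0 (u n - x) => u0 y0.
  apply: (@le_trans _ _ (e / (nrm y + 1) * (nrm y + 1))).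
    by rewrite ler_pM// lerDl.
  by rewrite divfK// gt_eqF// ltr_wpDl.
have h1 := le_trans (Re_inner_le (u n - x) y) h.
have h2 := Re_inner_le (- (u n - x)) y; rewrite nrmN in h2.
have {}h2 := le_trans h2 h.
move: h1 h2; rewrite innerNl innerDl innerNl.
case: ⟪ _, _ ⟫ => a b; case: ⟪ _, _ ⟫ => c d /=; rewrite ler_norml => ? ?.
apply/andP; split; lra.
Qed.

Lemma saRe A :
  (forall x y, complex.Re ⟪ A x, y ⟫ = complex.Re ⟪ x, A y ⟫) -> selfadjoint A.
Proof.
move=> h x y; have := h x y; have := h ('i *: x) y.
rewrite opZ !innerZl; case: ⟪ _, _ ⟫ => a b; case: ⟪ _, _ ⟫ => c d /=.
by rewrite !mul0r !sub0r !mul1r => /oppr_inj -> ->.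
Qed.

Section LimitOrder.
Variables (T : Type) (F : set_system T) (FF : ProperFilter F).
Variables (Z : T -> 'B(H)) (L : 'B(H)).
Hypothesis ZL : forall x, Z n x @[n --> F] --> L x.

Lemma commute_lim B : (forall n, commute B (Z n)) -> commute B L.
Proof using FF ZL.
move=> BZ; apply: opP => x; rewrite !mulopE.
apply: (@cvg_unique_nrm _ F _ (fun n => B (Z n x))).
  exact: op_cvg.
rewrite (_ : (fun n => B (Z n x)) = (fun n => Z n (B x))); first exact: ZL.
by apply/funext => n; rewrite -!mulopE BZ.
Qed.

Lemma sa_lim : (\forall n \near F, selfadjoint (Z n)) -> selfadjoint L.
Proof using FF ZL.
move=> sZ; apply: saRe => x y.
have ReC (u v : H) : complex.Re ⟪ u, v ⟫ = complex.Re ⟪ v, u ⟫.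
  by rewrite innerC; case: ⟪ _, _ ⟫.
have h1 : complex.Re ⟪ Z n x, y ⟫ @[n --> F] --> complex.Re ⟪ L x, y ⟫.
  exact: cvg_Re_inner.
have h2 : complex.Re ⟪ Z n y, x ⟫ @[n --> F] --> complex.Re ⟪ L y, x ⟫.
  exact: cvg_Re_inner.
rewrite [RHS]ReC; apply: (cvg_unique (@Rhausdorff R) h1).
apply: cvg_trans h2; apply: near_eq_cvg.
by apply: filterS sZ => n sZ; rewrite sZ ReC.
Qed.

Lemma posop_lim : (\forall n \near F, posop (Z n)) -> posop L.
Proof using FF ZL.
move=> pZ; apply/posopE; split.
  by apply: sa_lim; apply: filterS pZ => n /posop_sa.
move=> x; have h : q (Z n) x @[n --> F] --> q L x by exact: cvg_Re_inner.
by apply: (cvgr_to_ge h); apply: filterS pZ => n; exact: posop_q.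
Qed.

End LimitOrder.

(** Bounded operators form a Banach space; what is used of this is that a
    sequence whose increments are dominated by those of a bounded real sequence
    converges pointwise to a bounded operator. *)
Lemma op_limit (Z : nat -> 'B(H)) (y : nat -> R) (M : R) :
  (forall n x, nrm ((Z n.+1 - Z n) x) <= (y n.+1 - y n) * nrm x) ->
  (forall n, y n <= M) -> (forall n, y n <= y n.+1) ->
  exists L : 'B(H), forall x, Z n x @[n --> \oo] --> L x.
Proof.
move=> ZS yM yS.
have h x : exists l : H, Z n x @[n --> \oo] --> l.
  apply: (dominated_cvg (y := y) (M := M) (c := nrm x)) => //.
    exact: nrm_ge0.
  by move=> n; rewrite mulrC ZS.
have [f fP] := choice h.
have [K K0 ZK] := op_bounded (Z 0%N).
have Zb n x : nrm (Z n x) <= (K + (y n - y 0%N)) * nrm x.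
  elim: n => [|n IH]; first by rewrite subrr addr0.
  have -> : Z n.+1 x = Z n x + (Z n.+1 - Z n) x by rewrite addopE oppopE addrC subrK.
  rewrite (le_trans (nrmD _ _))//.
  have -> : K + (y n.+1 - y 0%N) = K + (y n - y 0%N) + (y n.+1 - y n) by ring.
  by rewrite mulrDl lerD.
have fb : f \in @bounded_linear R H.
  apply/bounded_linearP; split.
    move=> k x z; apply: cvg_unique_nrm (fP _) _.
    have -> : (fun n => Z n (k *: x + z)) = (fun n => k *: Z n x + Z n z).
      by apply/funext => n; rewrite opD opZ.
    apply: cvgD (fP z); apply: cvgZl_tmp; exact: fP.
  exists (K + (M - y 0%N) + 1)%:C => x; rewrite !nrmE -rmorphM/= lecR.
  apply/ler_addgt0Pr => e e0.
  have h0 : \forall n \near \oo, nrm (Z n x - f x) <= e by exact: cvg_nrm (fP x) _ e0.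
  near \oo => n.
  have -> : f x = Z n x - (Z n x - f x) by rewrite opprB addrC subrK.
  rewrite (le_trans (nrmB _ _))// lerD//; last by near: n.
  rewrite (le_trans (Zb n x))// ler_wpM2r ?nrm_ge0//.
  by have := yM n; lra.
by exists (BoundedOp fb) => x; exact: fP.
Unshelve. all: by end_near. Qed.

(** The Neumann series of [1 - A / c]. *)
Lemma op_inverse A (e : R) : selfadjoint A -> 0 < e ->
  (forall x, e * nrm x ^+ 2 <= q A x) ->
  exists W : 'B(H), A * W = 1 /\ W * A = 1.
Proof.
move=> sA e0 Ae; have [c' c'0 Ac'] := q_ub A.
pose c := c' + e; have c0 : 0 < c by rewrite /c; lra.
have Ac x : q A x <= c * nrm x ^+ 2.
  by rewrite (le_trans (Ac' x))// ler_wpM2r ?sqr_ge0// /c; lra.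
pose X : 'B(H) := 1 - c^-1 ∙ A; pose r := 1 - e / c.
have r0 : 0 <= r by rewrite /r subr_ge0 ler_pdivrMr// mul1r /c; lra.
have r1 : r < 1 by rewrite /r gtrDl oppr_lt0 divr_gt0.
have pX : posop X.
  apply/posopE; split; first by apply: saB => //; exact: saZ.
  by move=> x; rewrite !qE subr_ge0 mulrC ler_pdivrMr// mulrC.
have Xr x : nrm (X x) <= r * nrm x.
  apply: pos_nrm_le => // z; rewrite !qE /r mulrBl mul1r lerD2l lerN2.
  by rewrite mulrAC mulrC ler_pM2l ?invr_gt0.
pose Z := fix Z n : 'B(H) := if n is n'.+1 then 1 + X * Z n' else 0.
have ZS n x : nrm ((Z n.+1 - Z n) x) <= r ^+ n * nrm x.
  elim: n => [|n IH]; first by rewrite /= mulr0 addr0 subr0 expr0 mul1r.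
  have -> : Z n.+2 - Z n.+1 = X * (Z n.+1 - Z n).
    by rewrite /= mulrBr opprD addrACA subrr add0r.
  rewrite mulopE (le_trans (Xr _))// exprS -mulrA.
  by rewrite ler_wpM2l.
have [L ZL] : exists L : 'B(H), forall x, Z n x @[n --> \oo] --> L x.
  apply: (@op_limit Z (fun n => (1 - r ^+ n) / (1 - r)) ((1 - r)^-1)).
  - move=> n x; rewrite (le_trans (ZS n x))// le_eqVlt; apply/orP; left.
    apply/eqP; congr (_ * _); rewrite exprS; field; lra.
  - move=> n; rewrite ler_pdivrMr ?mulVf ?subr_gt0//; last by lra.
    by rewrite gerBl exprn_ge0.
  - move=> n; rewrite ler_pM2r ?invr_gt0 ?subr_gt0// lerD2l lerN2.
    by rewrite exprS ler_piMl ?exprn_ge0// ltW.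
have XZ n : commute X (Z n).
  elim: n => [|n IH]; first exact: commr0.
  by apply: commrD; [exact: commr1|exact: commrM].
have XL : commute X L by exact: commute_lim ZL _ XZ.
have LE : L = 1 + X * L.
  apply: opP => x; apply: (@cvg_unique_nrm _ \oo _ (fun n => Z n.+1 x)).
    by have := ZL x; rewrite -(cvg_shiftS (fun n => Z n x)).
  apply: cvgD; first exact: cvg_cst.
  by apply: op_cvg; exact: ZL.
have AE : A = c ∙ (1 - X).
  by rewrite subKr scalerA -rmorphM/= divff ?gt_eqF// scale1r.
have h : (1 - X) * L = 1 by rewrite mulrBl mul1r {1}LE addrK.
exists (c^-1 ∙ L); rewrite AE !scaleopAl !scaleopAr !scalerA -!rmorphM/=.
rewrite mulfV ?mulVf ?gt_eqF// !scale1r; split=> //.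
by rewrite -[RHS]h mulrBr mulrBl mulr1 mul1r XL.
Qed.

Lemma inv_commute A W B : A * W = 1 -> W * A = 1 -> commute B A -> commute B W.
Proof.
move=> AW WA BA.
by rewrite /commute -[B * W]mul1r -WA -!mulrA (mulrA A) -BA -(mulrA B) AW mulr1.
Qed.

Lemma inv_sa A W : A * W = 1 -> selfadjoint A -> selfadjoint W.
Proof.
move=> AW sA x y.
have e z : A (W z) = z by rewrite -mulopE AW.
by rewrite -[y in LHS]e -[x in RHS]e sA.
Qed.

(** The iteration [Y <- (X + Y^2) / 2] solves [(1 - Y)^2 = 1 - X]. Its increments
    are dominated by those of the scalar iteration that starts with [X = 1]. *)
Lemma op_sqrt1 A : posop A -> (forall x, q A x <= nrm x ^+ 2) ->
  exists S : 'B(H),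
    [/\ posop S, S * S = A & forall B, commute B A -> commute B S].
Proof.
move=> pA A1; have sA := posop_sa pA.
have half_ge0 : 0 <= 2^-1 :> R by rewrite invr_ge0.
pose X : 'B(H) := 1 - A.
have pX : posop X.
  apply/posopE; split; first exact: saB.
  by move=> x; rewrite !qE subr_ge0.
have X1 x : nrm (X x) <= nrm x.
  rewrite -[leRHS]mul1r; apply: pos_nrm_le => // z.
  by rewrite !qE mul1r gerBl posop_q.
pose Y := fix Y n : 'B(H) := if n is n'.+1 then 2^-1 ∙ (X + Y n' * Y n') else 0.
pose y := fix y n : R := if n is n'.+1 then (1 + y n' ^+ 2) / 2 else 0.
have yb n : 0 <= y n <= 1.
  elim: n => [|n /andP[y0 y1]]; first by rewrite lexx ler01.
  by apply/andP; split => /=; nra.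
have yS n : y n <= y n.+1.
  by rewrite [y n.+1]/=; have := sqr_ge0 (1 - y n); move: (y n) => t; nra.
have sY n : selfadjoint (Y n).
  elim: n => [|n IH]; first exact: sa0.
  by apply/saZ/saD; [exact: posop_sa|exact: sa_sqr].
have Yb n x : nrm (Y n x) <= y n * nrm x.
  elim: n x => [|n IH] x; first by rewrite mul0r nrm0.
  have /andP[y0 _] := yb n.
  rewrite /= scaleopE nrmZ ger0_norm//.
  rewrite addopE mulopE mulrAC [leRHS]mulrC ler_wpM2l//.
  rewrite (le_trans (nrmD _ _))// mulrDl mul1r lerD// (le_trans (IH _))//.
  by rewrite expr2 -mulrA ler_wpM2l.
have YC B : commute B A -> forall n, commute B (Y n).
  move=> BA; elim=> [|n IH]; first exact: commr0.
  apply/commuteZ/commrD; last exact: commrM.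
  by apply: commrB => //; exact: commr1.
have YY n m : commute (Y n) (Y m).
  by apply/YC/commr_sym/YC.
have YSE n : Y n.+2 - Y n.+1 = 2^-1 ∙ ((Y n.+1 + Y n) * (Y n.+1 - Y n)).
  rewrite [Y n.+2]/= [Y n.+1 in LHS]/= -/(Y n.+1) -scalerBr; congr (_ *: _).
  rewrite opprD addrACA subrr add0r mulrDl !mulrBr (YY n n.+1).
  by rewrite addrA subrK.
have YS n x : nrm ((Y n.+1 - Y n) x) <= (y n.+1 - y n) * nrm x.
  elim: n x => [|n IH] x.
    rewrite /= mulr0 addr0 subr0 scaleopE nrmZ ger0_norm//.
    by rewrite expr0n addr0 subr0 mul1r ler_wpM2l.
  rewrite YSE scaleopE nrmZ ger0_norm//.
  have -> : y n.+2 - y n.+1 = 2^-1 * ((y n.+1 + y n) * (y n.+1 - y n)).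
    by rewrite /=; move: (y n) => t; field.
  rewrite -!mulrA ler_wpM2l//.
  rewrite mulopE addopE (le_trans (nrmD _ _))// mulrDl.
  have /andP[y0 _] := yb n; have /andP[y0' _] := yb n.+1.
  by rewrite lerD// (le_trans (Yb _ _))// ler_wpM2l.
have [L YL] : exists L : 'B(H), forall x, Y n x @[n --> \oo] --> L x.
  by apply: (@op_limit Y y 1) => // n; have /andP[] := yb n.
have LE : L = 2^-1 ∙ (X + L * L).
  apply: opP => x; apply: (@cvg_unique_nrm _ \oo _ (fun n => Y n.+1 x)).
    by have := YL x; rewrite -(cvg_shiftS (fun n => Y n x)).
  apply: cvgZl_tmp; apply: cvgD; first exact: cvg_cst.
  change (Y n (Y n x) @[n --> \oo] --> L (L x)).
  have h1 : L (Y n x) @[n --> \oo] --> L (L x) by apply: op_cvg; exact: YL.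
  apply: nrm_cvg => e e0.
  have e20 : 0 < e / 2 by lra.
  have h2 : \forall n \near \oo, nrm (Y n (L x) - L (L x)) <= e / 2.
    exact: cvg_nrm (YL _) _ e20.
  have h3 : \forall n \near \oo, nrm (Y n x - L x) <= e / 2.
    exact: cvg_nrm (YL _) _ e20.
  near=> n; have -> : Y n (Y n x) - L (L x) =
      Y n (Y n x - L x) + (Y n (L x) - L (L x)) by rewrite opB subrKA.
  rewrite (le_trans (nrmD _ _))// (splitr e) lerD//; last by near: n.
  have /andP[y0 y1] := yb n.
  rewrite (le_trans (Yb _ _))// (@le_trans _ _ (1 * (e / 2)))//; last by rewrite mul1r.
  by apply: ler_pM => //; [exact: nrm_ge0|near: n].
have Lb x : nrm (L x) <= nrm x.
  apply/ler_addgt0Pr => e e0.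
  have h2 : \forall n \near \oo, nrm (Y n x - L x) <= e by exact: cvg_nrm (YL _) _ e0.
  near \oo => n; have -> : L x = Y n x - (Y n x - L x) by rewrite opprB addrC subrK.
  rewrite (le_trans (nrmB _ _))// lerD//; last by near: n.
  rewrite (le_trans (Yb _ _))// ler_piMl ?nrm_ge0//.
  by have /andP[] := yb n.
have sL : selfadjoint L.
  by apply: sa_lim YL _; exact: nearW.
exists (1 - L); split.
- apply/posopE; split; first exact: saB.
  move=> x; rewrite !qE subr_ge0 (le_trans (Re_inner_le _ _))// expr2.
  by rewrite ler_wpM2r ?nrm_ge0.
- have h : L + L = X + L * L.
    rewrite {1 2}LE -scalerDl -rmorphD/= (_ : 2^-1 + 2^-1 = 1) ?scale1r//.
    by field.
  have LL : L * L = L + L - X by rewrite h addrC addKr.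
  rewrite mulrBl mul1r mulrBr mulr1 LL opprB (addrAC (L + L)) addrK subrKA.
  by rewrite /X subKr.
- move=> B BA; apply: commrB; first exact: commr1.
  exact: commute_lim YL _ (YC _ BA).
Unshelve. all: by end_near. Qed.

Lemma op_sqrt A : posop A ->
  exists S : 'B(H),
    [/\ posop S, S * S = A & forall B, commute B A -> commute B S].
Proof.
move=> pA; have [c' c'0 Ac'] := q_ub A; pose c := c' + 1.
have c0 : 0 < c by rewrite /c; lra.
have [] := @op_sqrt1 (c^-1 ∙ A).
- apply/posopE; split; first exact/saZ/posop_sa.
  by move=> x; rewrite qE mulr_ge0 ?invr_ge0 ?posop_q// ltW.
- move=> x; rewrite qE mulrC ler_pdivrMr// mulrC (le_trans (Ac' x))//.
  by rewrite ler_wpM2r ?sqr_ge0// /c; lra.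
move=> S [pS SA SC]; exists (Num.sqrt c ∙ S); split.
- apply/posopE; split; first exact/saZ/posop_sa.
  by move=> x; rewrite qE mulr_ge0 ?sqrtr_ge0 ?posop_q.
- rewrite scaleopAl scaleopAr scalerA -rmorphM/= -expr2 sqr_sqrtr ?ltW// SA.
  by rewrite scalerA -rmorphM/= mulfV ?gt_eqF// scale1r.
- by move=> B BA; apply/commuteZ/SC/commuteZ.
Qed.

Lemma posopM A B : posop A -> posop B -> commute A B -> posop (A * B).
Proof.
move=> pA pB AB; have [S [pS SA SC]] := op_sqrt pA.
have BS : commute B S by apply/SC/commr_sym.
by rewrite -SA -mulrA -BS mulrA; apply: posop_conj => //; exact: posop_sa.
Qed.

End StrongLimits.

(** * Localization on the spectrum of an operator *)

Section Localization.
Context {R : realType} {H : hilbertType R}.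
Local Notation I := (1 : 'B(H)).
Implicit Types (A B C D E G K N P Q S T W X Z : 'B(H)) (x y : H) (r s l m M e c : R).

Lemma sa_of_ge e A : e ∙ I <=op A -> selfadjoint A.
Proof.
by move=> /posop_sa h; rewrite -(subrK (e ∙ I) A); exact/saD/sa_real.
Qed.

Lemma sqr_eq0 A : selfadjoint A -> A * A = 0 -> A = 0.
Proof.
move=> sA AA; apply: opP => x; apply: nrm_eq0; apply/eqP.
by rewrite -sqrf_eq0 -q_sqr// AA q0.
Qed.

Lemma invertible_sqrt D e : 0 < e -> e ∙ I <=op D ->
  exists C W, [/\ selfadjoint C, C * C = D, C * W = 1, W * C = 1 &
    forall B, commute B D -> commute B C].
Proof.
move=> e0 eD; have sD := sa_of_ge eD.
have Dq x : e * nrm x ^+ 2 <= q D x by have := leop_q x eD; rewrite !qE.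
have [V [DV VD]] := op_inverse sD e0 Dq.
have [|C [pC CD CC]] := @op_sqrt _ _ D.
  apply/posopE; split=> // x; apply: le_trans (Dq x).
  by rewrite mulr_ge0 ?sqr_ge0// ltW.
have CV : commute C V by apply: (inv_commute DV VD); rewrite /commute -CD mulrA.
exists C, (C * V); split => //; first exact: posop_sa.
- by rewrite mulrA CD.
- by rewrite CV -mulrA CD.
Qed.

(** The positive and negative parts [P] and [Q] of [X], with [P + Q] in the role
    of the absolute value. Positivity of [P] and [Q] themselves is avoided by
    working with their squares. *)
Lemma jordan_decomposition X : selfadjoint X ->
  exists P Q, [/\ selfadjoint P /\ selfadjoint Q, X = P - Q, posop (P + Q),
     P * Q = 0 /\ Q * P = 0 &
     forall B, commute B X -> commute B P /\ commute B Q].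
Proof.
move=> sX; have [K [pK KX KC]] := op_sqrt (posop_sqr sX).
have sK := posop_sa pK.
have XK : commute X K by apply: KC; exact: commrM.
have half : 2^-1 + 2^-1 = 1 :> R by field.
exists (2^-1 ∙ (K + X)), (2^-1 ∙ (K - X)); split.
- by split; apply: saZ; [exact: saD|exact: saB].
- rewrite -scalerBr opprD opprK addrACA subrr add0r scalerDr -scalerDl.
  by rewrite -rmorphD/= half scale1r.
- rewrite -scalerDr addrACA subrr addr0 scalerDr -scalerDl.
  by rewrite -rmorphD/= half scale1r.
- rewrite !scaleopAl !scaleopAr !scalerA; split.
    by rewrite mulrDl !mulrBr KX XK addrA subrK subrr scaler0.
  by rewrite mulrBl !mulrDr KX XK opprD addrA addrK subrr scaler0.
- move=> B BX; have BK : commute B K by apply: KC; exact: commrM.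
  by split; apply: commuteZ; [exact: commrD|exact: commrB].
Qed.

(** [G] plays the part of a function of [T] that is concentrated on [[l, r]]. At
    each step it is multiplied by the square of the positive or of the negative
    part of [T - c], where [c] is the midpoint; the two cannot both annihilate
    [N * G] unless [T] equals [c] there. *)
Lemma bisection T N m M (k : nat) : selfadjoint T -> m <= M ->
  m ∙ I <=op T -> T <=op M ∙ I -> posop N -> N <> 0 ->
  commute N T ->
  exists l r G, [/\ m <= l /\ r <= M, r - l = (M - m) / 2 ^+ k,
    posop G /\ (forall B, commute B T -> commute B G), N * G <> 0 &
    l ∙ (N * G) <=op T * (N * G) /\ T * (N * G) <=op r ∙ (N * G)].
Proof.
move=> sT mM mT TM pN N0 NT.
have subE s Y : (T - s ∙ I) * Y = T * Y - s ∙ Y.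
  by rewrite mulrBl scaleopAl mul1r.
have Esub s Y : (s ∙ I - T) * Y = s ∙ Y - T * Y.
  by rewrite mulrBl scaleopAl mul1r.
elim: k => [|k IH].
  exists m, M, 1; rewrite expr0 divr1 mulr1; split=> //.
  - split; last by move=> B _; exact: commr1.
    by apply/posopE; split=> [|x]; [exact: sa1|rewrite q1 sqr_ge0].
  - split; rewrite /leop -?subE -?Esub; apply: posopM => //;
      by apply/commr_sym/commrB => //; exact: commute_real.
have {IH} [l [r [G [[ml rM] rl [pG GC] NG0 [lN rN]]]]] := IH.
pose c := (l + r) / 2; pose X := T - c ∙ I.
have sX : selfadjoint X by apply: saB => //; exact: sa_real.
have [P [Q [[sP sQ] XPQ pK [PQ QP] PC]]] := jordan_decomposition sX.
have TX B : commute B T -> commute B X.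
  by move=> BT; apply: commrB => //; exact: commute_real.
have NGT : commute (N * G) T.
  by apply/commr_sym/commrM; [exact/commr_sym|exact: GC].
have pNG : posop (N * G) by apply: posopM => //; exact: GC.
have [NGP NGQ] : commute (N * G) P /\ commute (N * G) Q by exact/PC/TX.
have [TP TQ] : commute T P /\ commute T Q by exact/PC/TX.
have NGX : commute (N * G) X by exact: TX.
have pw : r - c = (M - m) / 2 ^+ k.+1 /\ c - l = (M - m) / 2 ^+ k.+1.
  have -> : (M - m) / 2 ^+ k.+1 = (M - m) / 2 ^+ k / 2.
    by rewrite exprS invfM mulrA mulrAC.
  by rewrite -rl /c; split; field.
have lr : l <= r.
  by rewrite -subr_ge0 rl divr_ge0 ?subr_ge0 ?exprn_ge0.
have c_in : l <= c <= r by rewrite /c; apply/andP; split; lra.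
(* Compression by [P], resp. [Q], preserves the bounds already obtained. *)
have conjP Y F : selfadjoint F -> commute Y F -> posop Y -> posop (Y * (F * F)).
  by move=> sF YF pY; rewrite mulrA YF; exact: posop_conj.
have GF F : selfadjoint F -> (forall B, commute B T -> commute B F) ->
    posop (G * (F * F)) /\ (forall B, commute B T -> commute B (G * (F * F))).
  move=> sF FC; split; first by apply: conjP => //; exact/commr_sym/GC/commr_sym/FC.
  by move=> B BT; apply: commrM; [exact: GC|apply: commrM; exact: FC].
have bound s F : selfadjoint F -> commute (N * G) F -> commute T F ->
    (posop (T * (N * G) - s ∙ (N * G)) ->
     posop (T * (N * (G * (F * F))) - s ∙ (N * (G * (F * F))))) /\
    (posop (s ∙ (N * G) - T * (N * G)) ->
     posop (s ∙ (N * (G * (F * F))) - T * (N * (G * (F * F))))).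
  move=> sF NGF TF; have cY : commute F (T * (N * G)) /\ commute F (s ∙ (N * G)).
    by split; [apply: commrM|apply: commuteZ]; exact: commr_sym.
  have E1 : T * (N * (G * (F * F))) = T * (N * G) * (F * F) by rewrite !mulrA.
  have E2 : s ∙ (N * (G * (F * F))) = s ∙ (N * G) * (F * F).
    by rewrite scaleopAl !mulrA.
  rewrite E1 E2 -!mulrBl; split; apply: conjP => //; apply/commr_sym/commrB;
    by case: cY.
have NGKP : commute (N * G) (P + Q) by exact: commrD.
have pNGK : posop (N * G * (P + Q)) by exact: posopM.
have EP : (T - c ∙ I) * (N * (G * (P * P))) = N * G * (P + Q) * (P * P).
  rewrite -/X; have -> : N * (G * (P * P)) = N * G * P * P by rewrite !mulrA.
  rewrite !mulrA -(mulrA X) -NGX -!mulrA; congr (_ * (_ * _)).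
  rewrite !mulrA; congr (_ * _).
  by rewrite XPQ mulrBl mulrDl QP subr0 addr0.
have EQ : (T - c ∙ I) * (N * (G * (Q * Q))) = - (N * G * (P + Q) * (Q * Q)).
  rewrite -/X; have -> : N * (G * (Q * Q)) = N * G * Q * Q by rewrite !mulrA.
  rewrite !mulrA -(mulrA X) -NGX -!mulrA -!mulrN; congr (_ * (_ * _)).
  rewrite !mulrN !mulrA -mulNr; congr (_ * _).
  by rewrite XPQ mulrBl mulrDl PQ sub0r add0r.
have KP : commute P (P + Q) by apply: commrD => //; rewrite /commute PQ QP.
have KQ : commute Q (P + Q) by apply: commrD => //; rewrite /commute PQ QP.
have [NP|NP] := pselect (N * (G * (P * P)) = 0); last first.
  exists c, r, (G * (P * P)); split => //.
  - by case/andP: c_in => lc _; split=> //; apply: le_trans lc.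
  - by case: pw.
  - by apply: GF => // B /TX/PC[].
  - split; last by have [_] := bound r P sP NGP TP; apply.
    rewrite /leop -subE EP; apply: conjP => //.
    by apply/commr_sym/commrM => //; exact/commr_sym.
have [NQ|NQ] := pselect (N * (G * (Q * Q)) = 0); last first.
  exists l, c, (G * (Q * Q)); split => //.
  - by case/andP: c_in => _ cr; split=> //; apply: le_trans rM.
  - by case: pw.
  - by apply: GF => // B /TX/PC[].
  - split; first by have [+ _] := bound l Q sQ NGQ TQ; apply.
    rewrite /leop -opprB -subE EQ opprK; apply: conjP => //.
    by apply/commr_sym/commrM => //; exact/commr_sym.
(* Neither half carries [N * G], which is thus concentrated at [c]. *)
have NX : N * G * X = 0.
  apply: sqr_eq0; first by apply: saM => //; exact: posop_sa.
  have XX : N * G * (X * X) = 0.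
    have -> : X * X = P * P + Q * Q.
      by rewrite XPQ mulrBl !mulrBr PQ QP subr0 sub0r opprK.
    by rewrite mulrDr -!(mulrA N) NP NQ addr0.
  by rewrite -mulrA (mulrA X) -NGX -(mulrA (N * G)) XX mulr0.
have Tc : T * (N * G) = c ∙ (N * G).
  by apply/eqP; rewrite -subr_eq0 -subE -/X -NGX NX.
exists c, r, G; split=> //.
- by case/andP: c_in => lc _; split=> //; apply: le_trans lc.
- by case: pw.
- by split=> //; rewrite Tc; exact: leop_refl.
Qed.

(** The criterion by which functions of [T] are compared without a functional
    calculus. If [Z] is not positive, then [Z <= - eta] on the range of a nonzero
    [Q * Q]. Bisecting [T] on this range yields a nonzero [N] on which the
    admissible error [c * (r - l)] is smaller than [eta], a contradiction. *)
Lemma posop_local T Z m M c : m <= M ->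
  m ∙ I <=op T -> T <=op M ∙ I ->
  selfadjoint Z -> commute Z T -> 0 <= c ->
  (forall l r N, posop N ->
    (forall B, commute B Z -> commute B T -> commute B N) ->
    m <= l -> l <= r -> r <= M ->
    l ∙ N <=op T * N -> T * N <=op r ∙ N ->
    forall x, - (c * (r - l)) * q N x <= q (Z * N) x) ->
  posop Z.
Proof.
move=> mM mT TM sZ ZT c0 loc; have sT := sa_of_ge mT.
apply/posopE; split=> // x; rewrite leNgt; apply/negP => Zx.
have nx : 0 < nrm x ^+ 2.
  rewrite exprn_even_gt0//=; apply/negP => /eqP /nrm_eq0 x0.
  by move: Zx; rewrite x0 /q inner0r ltxx.
(* With this [eta], the form of [Z + eta] is still negative at [x]. *)
pose eta := - q Z x / (2 * nrm x ^+ 2).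
have eta0 : 0 < eta by apply: divr_gt0; lra.
pose X := Z + eta ∙ I.
have sX : selfadjoint X by apply: saD => //; exact: sa_real.
have Xx : q X x < 0.
  rewrite !qE /eta.
  have -> : - q Z x / (2 * nrm x ^+ 2) * nrm x ^+ 2 = - q Z x / 2.
    by field; rewrite -sqrf_eq0 gt_eqF.
  lra.
have [P [Q [[sP sQ] XPQ pK [PQ QP] PC]]] := jordan_decomposition sX.
have CQ B : commute B Z -> commute B Q.
  move=> BZ; suff /PC[] : commute B X by [].
  by apply: commrD => //; exact: commute_real.
have QQ0 : Q * Q <> 0.
  move=> /(sqr_eq0 sQ) Q0; move: Xx; rewrite ltNge => /negP; apply.
  by apply: posop_q; move: pK; rewrite XPQ Q0 subr0 addr0.
have TQ : commute T Q by apply/CQ/commr_sym.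
have XQQ : posop (- (X * (Q * Q))).
  have -> : - (X * (Q * Q)) = Q * (P + Q) * Q.
    by rewrite mulrA XPQ mulrBl PQ sub0r mulNr opprK mulrDr QP add0r.
  exact: posop_conj.
have [k hk] : exists k : nat, c * ((M - m) / 2 ^+ k) < eta.
  exists (Num.bound (c * (M - m) / eta)).
  rewrite mulrA ltr_pdivrMr ?exprn_gt0// [ltRHS]mulrC -ltr_pdivrMr//.
  exact: upper_nthrootP.
have [|l [r [G [[ml rM] rl [pG GC] NG0 [lN rN]]]]] :=
  @bisection T (Q * Q) m M k sT mM mT TM (posop_sqr sQ) QQ0.
  by apply/commr_sym/commrM.
have GQ : commute Q G by apply/GC/commr_sym.
set N := Q * Q * G in NG0 lN rN.
have pN : posop N.
  by apply: posopM => //; [exact: posop_sqr|apply/commr_sym/commrM; exact/commr_sym].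
have lr : l <= r by rewrite -subr_ge0 rl divr_ge0 ?subr_ge0 ?exprn_ge0.
have NC B : commute B Z -> commute B T -> commute B N.
  move=> BZ BT; apply: commrM; last exact: GC.
  by apply: commrM; exact: CQ.
have XT : commute X T.
  by apply/commr_sym/commrD; [exact/commr_sym|exact: commute_real].
have XN : posop (- (X * N)).
  rewrite /N mulrA -mulNr; apply: posopM => //.
  apply/commr_sym/commrN; apply: commrM; first by exact/commr_sym/GC.
  by apply: commrM; exact/commr_sym.
apply: NG0; apply: pos_eq0 => // y.
have h1 := loc l r N pN NC ml lr rM lN rN y.
have h2 := posop_q y XN.
rewrite qN /X mulrDl qD scaleopAl mul1r qZ in h2.
have h3 := posop_q y pN.
rewrite rl in h1.
move: h1 h2 h3 hk; move: (q N y) (q (Z * N) y) (c * _) => u v w h1 h2 h3 hk.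
nra.
Qed.

End Localization.

(** * Affine bounds for operator means *)

Lemma le_of_le_addZ (R : realFieldType) (a b c : R) :
  (forall e, 0 < e -> a <= b + e * c) -> a <= b.
Proof.
move=> h; apply/ler_addgt0Pr => e e0.
have d0 : 0 < `|c| + 1 by rewrite ltr_wpDl.
have ed0 : 0 < e / (`|c| + 1) by rewrite divr_gt0.
rewrite (le_trans (h _ ed0))// lerD2l mulrAC ler_pdivrMr//.
by rewrite ler_pM2l//; have := ler_norm c; lra.
Qed.

Section Means.
Context {R : realType} {H : hilbertType R}.
Local Notation I := (1 : 'B(H)).
Implicit Types (A B C D E N S T U V W X Y Z : 'B(H)) (x y : H) (r s l m M e c d : R).

Lemma sposop_ge A e : 0 < e -> e ∙ I <=op A -> sposop A.
Proof.
move=> e0 eA; have sA := sa_of_ge eA; split=> // x x0.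
rewrite q_real// ltcR (lt_le_trans _ (leop_q x eA))// !qE mulr_gt0//.
by rewrite exprn_even_gt0//=; apply: contra_neq x0; exact: nrm_eq0.
Qed.

Lemma sposop_conj C W A : selfadjoint C -> W * C = 1 -> sposop A ->
  sposop (C * A * C).
Proof.
move=> sC WC [sA pA]; split; first exact: sa_conj.
move=> x x0; rewrite !mulopE sC; apply: pA; apply: contra_neq x0 => Cx.
by rewrite -[x]/((1 : 'B(H)) x) -WC mulopE Cx op0.
Qed.

Lemma sposop_real l : 0 < l -> sposop (l ∙ I).
Proof. by move=> l0; apply: (sposop_ge l0); exact: leop_refl. Qed.

Lemma sposop1 : sposop I.
Proof. by have := sposop_real ltr01; rewrite scale1r. Qed.

Lemma posop_adj U V A : is_adjoint U V -> posop A -> posop (V * A * U).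
Proof.
move=> UV pA; have VU x y : ⟪ V x, y ⟫ = ⟪ x, U y ⟫.
  by rewrite innerC -UV -innerC.
split=> [x y|x].
  by rewrite !mulopE VU (posop_sa pA) UV.
by rewrite !mulopE VU; case: pA.
Qed.

Variables (sigma : 'B(H) -> 'B(H) -> 'B(H)) (f : R -> R).
Hypotheses (hsigma : operator_mean sigma) (hf : representing_function sigma f).

Lemma transformer A B C Cs : sposop A -> sposop B ->
  is_adjoint C Cs -> sposop (Cs * A * C) -> sposop (Cs * B * C) ->
  Cs * sigma A B * C <=op sigma (Cs * A * C) (Cs * B * C).
Proof using hsigma. exact: mean_transformer. Qed.

(** The reverse of the transformer inequality for [C] is the transformer
    inequality for its inverse. *)
Lemma mean_conj C W A B : selfadjoint C -> C * W = 1 -> W * C = 1 ->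
  sposop A -> sposop B -> C * sigma A B * C = sigma (C * A * C) (C * B * C).
Proof using hsigma.
move=> sC CW WC pA pB; have sW := inv_sa CW sC.
have pA' := sposop_conj sC WC pA; have pB' := sposop_conj sC WC pB.
have WX X : W * (C * X * C) * W = X.
  by rewrite !mulrA WC mul1r -!mulrA CW mulr1.
have CX X : C * (W * X * W) * C = X.
  by rewrite !mulrA CW mul1r -!mulrA WC mulr1.
apply: leop_anti; first exact: transformer.
have := @transformer (C * A * C) (C * B * C) W W pA' pB' sW.
rewrite !WX => /(_ pA pB) /(leop_conj sC).
by rewrite CX.
Qed.

(** Up to scale, [T] is the real part of the unitary [U = T + i sqrt (1 - T^2)].
    The mean of [1] and [T] is invariant under conjugation by [U]. *)
Lemma mean_commute T : sposop T -> commute (sigma 1 T) T.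
Proof using hsigma.
move=> pT; have sT : selfadjoint T by case: pT.
have [c' c'0 Tc'] := op_bounded T; pose c := c' + 1.
have c0 : 0 < c by rewrite /c; lra.
have [X XE] : exists X, X = c^-1 ∙ T by exists (c^-1 ∙ T).
have sX : selfadjoint X by rewrite XE; exact: saZ.
have pX : posop (1 - X * X).
  apply/posopE; split; first by apply: saB; [exact: sa1|exact: sa_sqr].
  move=> x; rewrite qB q1 q_sqr// subr_ge0 ler_pXn2r ?nnegrE ?nrm_ge0//.
  rewrite XE scaleopE nrmZ ger0_norm ?invr_ge0 ?(ltW c0)// ler_pdivrMl//.
  by rewrite (le_trans (Tc' x))// ler_wpM2r ?nrm_ge0// /c; lra.
have [K [pK KK KC]] := op_sqrt pX.
have XK : commute X K.
  by apply: KC; apply: commrB; [exact: commr1|exact: commrM].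
have TX : commute T X by rewrite XE; exact: commuteZ.
have TK : commute T K.
  by apply: KC; apply: commrB; [exact: commr1|exact: commrM].
have sK := posop_sa pK.
pose U := X + 'i%C *: K; pose V := X - 'i%C *: K.
have i2 : 'i%C * 'i%C = -1 :> R[i] by rewrite -expr2 sqr_i.
have UV1 : U * V = 1.
  rewrite mulrDl !mulrBr !scaleopAr !scaleopAl scalerA i2 scaleN1r opprK XK.
  by rewrite addrA subrK KK addrC subrK.
have VU1 : V * U = 1.
  rewrite mulrBl !mulrDr !scaleopAr !scaleopAl scalerA i2 scaleN1r XK.
  by rewrite opprD opprK addrA addrK KK addrC subrK.
have ci : conjc 'i%C = - 'i%C :> R[i].
  by apply/eqP; rewrite eq_complex /= oppr0 !eqxx.
have adj : is_adjoint U V.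
  move=> x y; rewrite !addopE oppopE !scaleopE innerDl innerDr innerNr innerZl innerZr.
  by rewrite sX sK ci mulNr opprK.
have adj' : is_adjoint V U.
  by move=> x y; rewrite innerC -adj -innerC.
have TU : commute T U by apply: commrD => //; exact: commuteZ.
have TV : commute T V by apply: commrB => //; exact: commuteZ.
have VTU : V * T * U = T by rewrite -TV -mulrA VU1 mulr1.
have UTV : U * T * V = T by rewrite -TU -mulrA UV1 mulr1.
set S := sigma 1 T.
have le1 : V * S * U <=op S.
  have := @transformer 1 T U V sposop1 pT adj.
  by rewrite mulr1 VU1 VTU; apply => //; exact: sposop1.
have le2 : U * S * V <=op S.
  have := @transformer 1 T V U sposop1 pT adj'.
  by rewrite mulr1 UV1 UTV; apply => //; exact: sposop1.
have SE : S = V * S * U.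
  apply: leop_anti => //.
  have := posop_adj adj le2; rewrite mulrBr mulrBl -/(_ <=op _).
  by rewrite !mulrA VU1 mul1r -!mulrA VU1 mulr1 !mulrA.
have SU : U * S = S * U by rewrite {1}SE !mulrA UV1 mul1r.
have SV : V * S = S * V by rewrite {2}SE -!mulrA UV1 mulr1.
have UVT : U + V = (2 * c^-1) ∙ T.
  rewrite /U /V addrACA subrr addr0 XE -scalerDl -rmorphD/=.
  by congr (_%:C *: _); ring.
have -> : T = (2^-1 * c) ∙ (U + V).
  rewrite UVT scalerA -rmorphM/= (_ : _ * _ = 1) ?scale1r//.
  by field; lra.
by apply/commuteZ/commrD; exact/esym.
Qed.

(** Congruence by the square root of [D]. *)
Lemma mean_mul T D e : sposop T -> 0 < e -> e ∙ I <=op D -> commute D T ->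
  commute D (sigma 1 T) -> D * sigma 1 T = sigma D (D * T).
Proof using hsigma.
move=> pT e0 eD DT DS.
have [C [W [sC CD CW WC CC]]] := invertible_sqrt e0 eD.
have h := mean_conj sC CW WC sposop1 pT.
have CT : commute C T by apply/commr_sym/CC/commr_sym.
have CS : commute C (sigma 1 T) by apply/commr_sym/CC/commr_sym.
have CSC : C * sigma 1 T * C = D * sigma 1 T by rewrite -mulrA -CS mulrA CD.
have CTC : C * T * C = D * T by rewrite -mulrA -CT mulrA CD.
by rewrite -CSC h mulr1 CTC CD.
Qed.

Lemma mean_scal E e l : 0 < l -> 0 < e -> e ∙ I <=op E ->
  sigma E (l ∙ E) = f l ∙ E.
Proof using hsigma hf.
move=> l0 e0 eE; have := mean_mul (sposop_real l0) e0 eE (commute_real _ _).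
have -> : sigma 1 (l ∙ I) = f l ∙ I by rewrite -[LHS](repr_mean hf).
by rewrite !scaleopAr !mulr1 => <- //; exact: commute_real.
Qed.

Lemma ge_addr N e : posop N -> e ∙ I <=op N + e ∙ I.
Proof. by rewrite /leop addrK. Qed.

Lemma le_scal E e l : 0 <= l -> e ∙ I <=op E -> (l * e) ∙ I <=op l ∙ E.
Proof.
move=> l0 eE; apply: leopP; [exact: sa_real|exact/saZ/(sa_of_ge eE)|].
by move=> z; have := leop_q z eE; rewrite !qE -mulrA => /ler_wpM2l; apply.
Qed.

Lemma sposop_mul N T e m : 0 < e -> 0 < m -> m ∙ I <=op T -> posop N ->
  commute N T -> sposop ((N + e ∙ I) * T).
Proof.
move=> e0 m0 mT pN NT; apply: (@sposop_ge _ (e * m)); first exact: mulr_gt0.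
have sT := sa_of_ge mT.
have pT : posop T.
  apply/posopE; split=> // x; have := leop_q x mT; rewrite !qE.
  by apply: le_trans; rewrite mulr_ge0 ?sqr_ge0// ltW.
have pNT := posopM pN pT NT.
apply: leopP; first exact: sa_real.
  by rewrite mulrDl scaleopAl mul1r; apply: saD; [exact: posop_sa|exact: saZ].
move=> x; rewrite mulrDl scaleopAl mul1r; have := posop_q x pNT.
have := leop_q x mT; rewrite !qE -mulrA => h1 h2.
by rewrite ler_wpDl// ler_wpM2l// ltW.
Qed.

(** On a piece [N] of [T] where [T] is bounded below by [l], the mean with [T] is
    compared with the mean with [l], which is [f l]. The operators [N] and [T * N]
    are perturbed so that they become invertible, in such a way that the order
    between [l * N] and [T * N] is kept. *)
Lemma local_lower T N m l :
  0 < m -> m <= l -> m ∙ I <=op T -> posop N ->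
  commute N T -> commute N (sigma 1 T) -> l ∙ N <=op T * N ->
  forall x, f l * q N x <= q (sigma 1 T * N) x.
Proof using hsigma hf.
move=> m0 ml mT pN NT NS lN x.
have l0 : 0 < l by exact: lt_le_trans ml.
have pT : sposop T by exact: sposop_ge mT.
have fl := repr_pos hf l0.
apply: (@le_of_le_addZ _ _ _ (q (sigma 1 T) x)) => e e0.
pose D := N + e ∙ I; pose E := N + (e * m / l) ∙ I.
(* The shift of [E] times [l] must not exceed the shift of [D] times [m]. *)
have eml0 : 0 < e * m / l by rewrite divr_gt0// mulr_gt0.
have sN := posop_sa pN; have sT := sa_of_ge mT.
have eD := ge_addr e pN; have eE := ge_addr (e * m / l) pN.
have DT : commute D T by apply/commr_sym/commrD; [exact/commr_sym|exact: commute_real].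
have DS : commute D (sigma 1 T).
  by apply/commr_sym/commrD; [exact/commr_sym|exact: commute_real].
have ED : E <=op D.
  apply: leopP; [exact: sa_of_ge eE|exact: sa_of_ge eD|].
  move=> z; rewrite !qE lerD2l ler_wpM2r ?sqr_ge0//.
  by rewrite -mulrA ler_piMr ?(ltW e0)// ler_pdivrMr// mul1r.
have lED : l ∙ E <=op D * T.
  apply: leopP; [exact/saZ/(sa_of_ge eE)|apply: saM => //; exact: sa_of_ge eD|].
  move=> z; rewrite mulrDl scaleopAl mul1r NT !qE mulrDr.
  apply: lerD; first by have := leop_q z lN; rewrite qE.
  rewrite mulrA (_ : l * (e * m / l) = e * m); last by field; rewrite gt_eqF.
  by rewrite -mulrA ler_wpM2l ?(ltW e0)//; have := leop_q z mT; rewrite !qE.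
have pE := sposop_ge eml0 eE; have pD := sposop_ge e0 eD.
have plE := sposop_ge (mulr_gt0 l0 eml0) (le_scal (ltW l0) eE).
have pDT := sposop_mul e0 m0 mT pN NT.
have := leop_q x (mean_mono hsigma pE pD plE pDT ED lED).
rewrite (mean_scal l0 eml0 eE) -(mean_mul pT e0 eD DT DS).
rewrite mulrDl scaleopAl mul1r NS !qE.
apply: le_trans; rewrite ler_wpM2l ?(ltW fl)// lerDl.
by rewrite mulr_ge0 ?sqr_ge0// ltW.
Qed.

Lemma local_upper T N m M r :
  0 < m -> 0 < r -> r <= M -> m ∙ I <=op T -> T <=op M ∙ I -> posop N ->
  commute N T -> commute N (sigma 1 T) -> T * N <=op r ∙ N ->
  forall x, q (sigma 1 T * N) x <= f r * q N x.
Proof using hsigma hf.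
move=> m0 r0 rM mT TM pN NT NS rN x.
have M0 : 0 < M by exact: lt_le_trans rM.
have pT : sposop T by exact: sposop_ge mT.
have fr := repr_pos hf r0.
apply: (@le_of_le_addZ _ _ _ (f r * (M / r * nrm x ^+ 2) - q (sigma 1 T) x)) => e e0.
pose D := N + e ∙ I; pose E := N + (e * M / r) ∙ I.
have emr0 : 0 < e * M / r by rewrite divr_gt0// mulr_gt0.
have sN := posop_sa pN; have sT := sa_of_ge mT.
have eD := ge_addr e pN; have eE := ge_addr (e * M / r) pN.
have DT : commute D T by apply/commr_sym/commrD; [exact/commr_sym|exact: commute_real].
have DS : commute D (sigma 1 T).
  by apply/commr_sym/commrD; [exact/commr_sym|exact: commute_real].
have DE : D <=op E.
  apply: leopP; [exact: sa_of_ge eD|exact: sa_of_ge eE|].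
  move=> z; rewrite !qE lerD2l ler_wpM2r ?sqr_ge0//.
  by rewrite -mulrA ler_peMr ?(ltW e0)// ler_pdivlMr// mul1r.
have DTr : D * T <=op r ∙ E.
  apply: leopP; [apply: saM => //; exact: sa_of_ge eD|exact/saZ/(sa_of_ge eE)|].
  move=> z; rewrite mulrDl scaleopAl mul1r NT !qE mulrDr.
  apply: lerD; first by have := leop_q z rN; rewrite qE.
  rewrite mulrA (_ : r * (e * M / r) = e * M); last by field; rewrite gt_eqF.
  by rewrite -mulrA ler_wpM2l ?(ltW e0)//; have := leop_q z TM; rewrite !qE.
have pE := sposop_ge emr0 eE; have pD := sposop_ge e0 eD.
have prE := sposop_ge (mulr_gt0 r0 emr0) (le_scal (ltW r0) eE).
have pDT := sposop_mul e0 m0 mT pN NT.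
have := leop_q x (mean_mono hsigma pD pE pDT prE DE DTr).
rewrite (mean_scal r0 emr0 eE) -(mean_mul pT e0 eD DT DS).
rewrite mulrDl scaleopAl mul1r NS !qE mulrDr.
have -> : f r * (e * M / r * nrm x ^+ 2) = e * (f r * (M / r * nrm x ^+ 2)) by ring.
by rewrite mulrBr; lra.
Qed.

Lemma mean_sa T : sposop T -> selfadjoint (sigma 1 T).
Proof using hsigma. by move=> pT; case: (mean_pos hsigma sposop1 pT). Qed.

(** Where [l <= T <= r], the affine function of [T] exceeds its value at [l] by at
    most [c * (r - l)], and the mean is at least [f l]. *)
Lemma mean1_ge_line T m M c d : 0 < m -> m <= M ->
  m ∙ I <=op T -> T <=op M ∙ I -> 0 <= c ->
  (forall t, m <= t -> t <= M -> d + c * t <= f t) ->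
  d ∙ I + c ∙ T <=op sigma 1 T.
Proof using hsigma hf.
move=> m0 mM mT TM c0 fcd; have pT := sposop_ge m0 mT.
have sT := sa_of_ge mT; have sS := mean_sa pT; have ST := mean_commute pT.
apply: (posop_local mM mT TM _ _ c0).
- by apply: saB => //; apply: saD; [exact: sa_real|exact: saZ].
- apply/commr_sym/commrB; first exact/commr_sym.
  by apply: commrD; [exact: commute_real|exact: commuteZ].
move=> l r N pN NC ml lr rM lN rN x.
have NT : commute N T.
  apply/commr_sym/NC => //; apply: commrB; first exact/commr_sym.
  by apply: commrD; [exact: commute_real|exact: commuteZ].
have NS : commute N (sigma 1 T).
  apply/commr_sym/NC => //; apply: commrB => //.
  by apply: commrD; [exact: commute_real|exact: commuteZ].
have h1 := local_lower m0 ml mT pN NT NS lN x.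
have h2 := leop_q x rN; have h3 := posop_q x pN.
have h4 := fcd l ml (le_trans lr rM).
rewrite mulrBl mulrDl !scaleopAl mul1r !qE.
rewrite qE in h2.
move: h1 h2 h3 h4; set u := q N x; set v := q (T * N) x; set w := q (_ * N) x.
move=> h1 h2 h3 h4.
have h5 : c * v <= c * (r * u) by rewrite ler_wpM2l.
have h6 : (d + c * l) * u <= f l * u by rewrite ler_wpM2r.
by lra.
Qed.

Lemma mean1_le_line T m M c d : 0 < m -> m <= M ->
  m ∙ I <=op T -> T <=op M ∙ I -> 0 <= c ->
  (forall t, 0 < t -> f t <= d + c * t) ->
  sigma 1 T <=op d ∙ I + c ∙ T.
Proof using hsigma hf.
move=> m0 mM mT TM c0 fcd; have pT := sposop_ge m0 mT.
have sT := sa_of_ge mT; have sS := mean_sa pT; have ST := mean_commute pT.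
apply: (posop_local mM mT TM _ _ c0).
- by apply: saB => //; apply: saD; [exact: sa_real|exact: saZ].
- apply/commr_sym/commrB; last exact/commr_sym.
  by apply: commrD; [exact: commute_real|exact: commuteZ].
move=> l r N pN NC ml lr rM lN rN x.
have NT : commute N T.
  apply/commr_sym/NC => //; apply: commrB; last exact/commr_sym.
  by apply: commrD; [exact: commute_real|exact: commuteZ].
have NS : commute N (sigma 1 T).
  apply/commr_sym/NC => //; apply: commrB => //.
  by apply: commrD; [exact: commute_real|exact: commuteZ].
have r0 : 0 < r by rewrite (lt_le_trans m0)// (le_trans ml).
have h1 := local_upper m0 r0 rM mT TM pN NT NS rN x.
have h2 := leop_q x lN; have h3 := posop_q x pN.
have h4 := fcd r r0.
rewrite mulrBl mulrDl !scaleopAl mul1r !qE.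
rewrite qE in h2.
move: h1 h2 h3 h4; set u := q N x; set v := q (T * N) x; set w := q (_ * N) x.
move=> h1 h2 h3 h4.
have h5 : c * (l * u) <= c * v by rewrite ler_wpM2l.
have h6 : f r * u <= (d + c * r) * u by rewrite ler_wpM2r.
by lra.
Qed.

(** Congruence by [A^(1/2)] reduces the mean of [A] and [B] to that of [1] and
    [T = A^(-1/2) B A^(-1/2)]. *)
Lemma mean_reduce A B e m M : 0 < e -> 0 < m -> e ∙ I <=op A ->
  m ∙ A <=op B -> B <=op M ∙ A ->
  exists C T, [/\ selfadjoint C, C * C = A, C * T * C = B,
    m ∙ I <=op T /\ T <=op M ∙ I & C * sigma 1 T * C = sigma A B].
Proof using hsigma.
move=> e0 m0 eA mB BM; have [C [W [sC CA CW WC _]]] := invertible_sqrt e0 eA.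
have sW := inv_sa CW sC; pose T := W * B * W.
have CTC : C * T * C = B.
  by rewrite /T !mulrA CW mul1r -mulrA WC mulr1.
have WAW : W * A * W = 1 by rewrite -CA !mulrA WC mul1r CW.
have mT : m ∙ I <=op T.
  by have := leop_conj sW mB; rewrite scaleopAr scaleopAl WAW.
exists C, T; split=> //.
  split=> //; by have := leop_conj sW BM; rewrite scaleopAr scaleopAl WAW.
by rewrite (mean_conj sC CW WC sposop1 (sposop_ge m0 mT)) mulr1 CA CTC.
Qed.

Lemma mean_ge_line A B e m M c d : 0 < e -> 0 < m -> m <= M ->
  e ∙ I <=op A -> m ∙ A <=op B -> B <=op M ∙ A -> 0 <= c ->
  (forall t, m <= t -> t <= M -> d + c * t <= f t) ->
  d ∙ A + c ∙ B <=op sigma A B.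
Proof using hsigma hf.
move=> e0 m0 mM eA mB BM c0 fcd.
have [C [T [sC CA CB [mT TM] <-]]] := mean_reduce e0 m0 eA mB BM.
have := leop_conj sC (mean1_ge_line m0 mM mT TM c0 fcd).
by rewrite mulrDr mulrDl !scaleopAr !scaleopAl mulr1 CA CB.
Qed.

Lemma mean_le_line A B e m M c d : 0 < e -> 0 < m -> m <= M ->
  e ∙ I <=op A -> m ∙ A <=op B -> B <=op M ∙ A -> 0 <= c ->
  (forall t, 0 < t -> f t <= d + c * t) ->
  sigma A B <=op d ∙ A + c ∙ B.
Proof using hsigma hf.
move=> e0 m0 mM eA mB BM c0 fcd.
have [C [T [sC CA CB [mT TM] <-]]] := mean_reduce e0 m0 eA mB BM.
have := leop_conj sC (mean1_le_line m0 mM mT TM c0 fcd).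
by rewrite mulrDr mulrDl !scaleopAr !scaleopAl mulr1 CA CB.
Qed.

End Means.

(** * Finite-dimensional Hilbert spaces *)

(** A type of its own, since matrices carry the maximum norm. *)
Definition ell2 (R : realType) (n : nat) : Type := 'rV[R[i]]_n.

HB.instance Definition _ (R : realType) n :=
  GRing.Lmodule.copy (ell2 R n) 'rV[R[i]]_n.
HB.instance Definition _ (R : realType) n :=
  Vector.copy (ell2 R n) 'rV[R[i]]_n.

Section Ell2.
Context {R : realType} {n : nat}.
Implicit Types x y z : ell2 R n.

Definition ell2_dot x y : R[i] := \sum_(i < n) x 0 i * (y 0 i)^*.

Lemma ell2_dot_bilinear :
  bilinear_for (@GRing.mul R[i]) (@Num.conj R[i] \; *%R) ell2_dot.
Proof.
split=> x k y z; rewrite /ell2_dot /= mulr_sumr -big_split/=; apply: eq_bigr => i _.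
  by rewrite !mxE mulrDl mulrA.
by rewrite !mxE rmorphD rmorphM/= mulrDr mulrCA.
Qed.

HB.instance Definition _ := bilinear_isBilinear.Build R[i] (ell2 R n) (ell2 R n)
  R[i] *%R (@Num.conj R[i] \; *%R) ell2_dot ell2_dot_bilinear.

Lemma ell2_dot_herm x y : ell2_dot x y = (-1) ^+ false * (ell2_dot y x)^*.
Proof.
rewrite expr0 mul1r rmorph_sum/=; apply: eq_bigr => i _.
by rewrite rmorphM/= conjCK mulrC.
Qed.

HB.instance Definition _ := @isHermitianSesquilinear.Build R[i] (ell2 R n)
  false (@Num.conj R[i]) ell2_dot ell2_dot_herm.

Lemma ell2_dot_gt0 x : x != 0 -> 0 < ell2_dot x x.
Proof.
move=> x0; rewrite lt0r; apply/andP; split; last first.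
  by apply: sumr_ge0 => i _; rewrite -normCK exprn_ge0.
apply: contra x0; rewrite psumr_eq0 => [|i _]; last by rewrite -normCK exprn_ge0.
move=> /allP h; apply/eqP/rowP => i; rewrite mxE; apply/eqP.
have := h i (mem_index_enum _); rewrite /= -normCK sqrf_eq0 normr_eq0.
exact.
Qed.

HB.instance Definition _ := @isDotProduct.Build R[i] (ell2 R n) ell2_dot ell2_dot_gt0.

End Ell2.

Section Ell2Norm.
Context {R : realType} {n : nat}.
Implicit Types x y z : ell2 R n.
Let dot : {dot ell2 R n for @Num.conj R[i]} := @ell2_dot R n.

Lemma ell2_dot_ge0 x : 0 <= ell2_dot x x.
Proof. exact: (dnorm_ge0 dot). Qed.

Definition ell2_norm x : R[i] := sqrtC (ell2_dot x x).

Lemma ell2_normD x y : ell2_norm (x + y) <= ell2_norm x + ell2_norm y.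
Proof. by have [+ _] := triangle_lerif dot x y. Qed.

Lemma ell2_normZ k x : ell2_norm (k *: x) = `|k| * ell2_norm x.
Proof.
rewrite /ell2_norm -[ell2_dot]/(dot : _ -> _ -> _) dnormZ.
rewrite sqrtCM ?nnegrE ?exprn_ge0 ?ell2_dot_ge0//.
by rewrite sqrCK.
Qed.

Lemma ell2_norm0_eq0 x : ell2_norm x = 0 -> x = 0.
Proof. by move/eqP; rewrite (sqrt_dnorm_eq0 dot) => /eqP. Qed.

HB.instance Definition _ := Lmodule_isNormed.Build R[i] (ell2 R n)
  ell2_normD ell2_normZ ell2_norm0_eq0.

Lemma ell2_coord_le x i : `|x 0 i| <= ell2_norm x.
Proof.
rewrite -(sqrCK (normr_ge0 _)) ler_sqrtC ?qualifE/= ?exprn_ge0//; last exact: ell2_dot_ge0.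
rewrite /ell2_dot (bigD1 i)//= -normCK lerDl sumr_ge0// => j _.
by rewrite -normCK exprn_ge0.
Qed.

Lemma ell2_norm_le x (e : R[i]) : 0 <= e -> (forall i, `|x 0 i| <= e) ->
  ell2_norm x <= e *+ n.
Proof.
move=> e0 xe; rewrite -(sqrCK (mulrn_wge0 n e0)).
rewrite ler_sqrtC ?qualifE/= ?exprn_ge0 ?mulrn_wge0//; last exact: ell2_dot_ge0.
apply: (@le_trans _ _ (\sum_(i < n) e ^+ 2)).
  by apply: ler_sum => i _; rewrite -normCK lerXn2r ?nnegrE.
rewrite sumr_const card_ord exprMn_n -(mulr_natr _ n) -(mulr_natr _ (n ^ 2)) ler_wpM2l ?exprn_ge0//.
by rewrite ler_nat; case: n => // k; rewrite leq_pmull.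
Qed.

Lemma ell2_normE x : `|x| = ell2_norm x.
Proof. by []. Qed.

Lemma ell2_complete (F : set_system (ell2 R n)) :
  ProperFilter F -> cauchy F -> cvg F.
Proof.
move=> FF Fc.
have lip (g : ell2 R n -> R) : (forall x y, (`|g x - g y|)%:C <= `|x - y|) ->
    exists l : R, g @ F --> l.
  move=> gl; suff h : cvg (g @ F) by exists (lim (g @ F)).
  apply: cauchy_cvg; apply/cauchy_exP => e e0.
  have e0c : 0 < e%:C by rewrite ltcR.
  have /cauchyP/(_ _ e0c)[x xF] := Fc.
  exists (g x); change (F [set y | ball (g x) e (g y)]).
  apply: filterS xF => y; rewrite -!ball_normE/= => h.
  by rewrite -ltcR; exact: le_lt_trans (gl _ _) h.
have Rele (z : R[i]) : `|complex.Re z|%:C <= `|z| by exact: normc_ge_Re.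
have Imle (z : R[i]) : `|complex.Im z|%:C <= `|z|.
  rewrite -(normrN z) -[`|- z|]mul1r; have := Rele (z * 'i%C).
  rewrite ReiNIm normrN normrM (_ : `|'i%C| = 1) ?mulr1 ?mul1r ?normrN//.
  by rewrite normc_def/= expr0n expr1n add0r sqrtr1.
have reP i : exists l : R, (fun x : ell2 R n => complex.Re (x 0 i)) @ F --> l.
  apply: lip => x y; rewrite -raddfB/=; apply: le_trans (Rele _) _.
  by have := ell2_coord_le (x - y) i; rewrite !mxE.
have [re hre] := choice reP.
have imP i : exists l : R, (fun x : ell2 R n => complex.Im (x 0 i)) @ F --> l.
  apply: lip => x y; rewrite -raddfB/=; apply: le_trans (Imle _) _.
  by have := ell2_coord_le (x - y) i; rewrite !mxE.
have [im him] := choice imP.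
apply/cvg_ex; exists (\row_i (re i +i* im i) : ell2 R n).
apply/cvgrPdist_le => /= -[e b]; rewrite ltcE/= => /andP[/eqP -> e0].
pose d := e / (2 * n.+1%:R).
have d0 : 0 < d by rewrite divr_gt0// mulr_gt0.
have h1 : \forall x \near F, forall i : 'I_n, `|re i - complex.Re ((x : ell2 R n) 0 i)| <= d.
  apply: filter_forall => i; move/cvgrPdist_le : (hre i); exact.
have h2 : \forall x \near F, forall i : 'I_n, `|im i - complex.Im ((x : ell2 R n) 0 i)| <= d.
  apply: filter_forall => i; move/cvgrPdist_le : (him i); exact.
apply: filterS2 h1 h2 => x h1 h2; rewrite ell2_normE.
have d2 : 0 <= (2 * d)%:C by rewrite ler0c mulr_ge0// ltW.
rewrite (le_trans (@ell2_norm_le _ (2 * d)%:C d2 _))//.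
  move=> i; rewrite !mxE; have := h1 i; have := h2 i.
  case: (x 0 i) => u v /= hv hu.
  have -> : (re i +i* im i - (u +i* v))%C = (re i - u)%:C + 'i%C * (im i - v)%:C.
    by apply/eqP; rewrite eq_complex /=; apply/andP; split; apply/eqP; ring.
  rewrite (le_trans (ler_normD _ _))// normrM (_ : `|'i%C| = 1); last first.
    by rewrite normc_def/= expr0n expr1n add0r sqrtr1.
  rewrite mul1r !normc_def/= expr0n !addr0 !sqrtr_sqr -rmorphD/= lecR; lra.
rewrite -rmorphMn/= lecR -mulr_natr /d.
have -> : 2 * (e / (2 * n.+1%:R)) * n%:R = e * (n%:R / n.+1%:R).
  by field.
by rewrite ler_piMr ?(ltW e0)// ler_pdivrMr// mul1r ler_nat.
Qed.

HB.instance Definition _ := Uniform_isComplete.Build (ell2 R n) ell2_complete.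

Lemma ell2_hnormE x : `|x| ^+ 2 = dot x x.
Proof. by rewrite ell2_normE sqrtCK. Qed.

HB.instance Definition _ := NormedModule_isHilbert.Build R (ell2 R n) ell2_hnormE.

End Ell2Norm.

(** * Concavity of operator monotone functions *)

Section RankOne.
Context {R : realType} {H : hilbertType R}.
Implicit Types (w e x y : H) (A P T D : 'B(H)).
Local Notation I := (1 : 'B(H)).

Lemma qZl A (k : R[i]) x : q A (k *: x) = complex.Re (k * conjc k) * q A x.
Proof.
rewrite /q opZ innerZl innerZr; case: ⟪ _, _ ⟫ => a b; case: k => c d /=; ring.
Qed.

Lemma cauchy_schwarz x y : `|⟪ x, y ⟫| <= (nrm x * nrm y)%:C.
Proof.
set z := ⟪ x, y ⟫; have [->|z0] := eqVneq z 0.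
  by rewrite normr0 ler0c mulr_ge0 ?nrm_ge0.
have nz : `|z| = (complex.Re `|z|)%:C by rewrite RRe_real// ger0_real.
have nz0 : 0 < complex.Re `|z| by rewrite -ltcR -nz normr_gt0.
rewrite nz lecR -(ler_pM2l nz0).
have h : ⟪ conjc z *: x, y ⟫ = (complex.Re `|z| ^+ 2)%:C.
  by rewrite innerZl -/z mulrC -sqr_normc nz -rmorphXn.
have := Re_inner_le (conjc z *: x) y; rewrite h /= expr2.
have -> : nrm (conjc z *: x) = complex.Re `|z| * nrm x.
  by apply: complexI; rewrite -nrmE normrZ normcJ nz nrmE -rmorphM.
by rewrite mulrA.
Qed.

Lemma rank1_subproof w : (fun x => ⟪ x, w ⟫ *: w) \in @bounded_linear R H.
Proof.
apply/bounded_linearP; split.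
  by move=> k x y; rewrite innerDl innerZl scalerDl scalerA.
exists (nrm w * nrm w)%:C => x; rewrite normrZ !nrmE.
apply: le_trans (ler_wpM2r _ (cauchy_schwarz x w)) _; first by rewrite ler0c nrm_ge0.
by rewrite -!rmorphM/= lecR -mulrA mulrC.
Qed.

Definition rank1 w : 'B(H) := BoundedOp (rank1_subproof w).

Lemma rank1E w x : rank1 w x = ⟪ x, w ⟫ *: w. Proof. by []. Qed.

Lemma rank1_sa w : selfadjoint (rank1 w).
Proof. by move=> x y; rewrite !rank1E innerZl innerZr -innerC mulrC. Qed.

Lemma rank1_idem w : ⟪ w, w ⟫ = 1 -> rank1 w * rank1 w = rank1 w.
Proof.
by move=> w1; apply: opP => x; rewrite mulopE !rank1E innerZl w1 mulr1.
Qed.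

(** The spectral form of an operator with eigenvalues [s] and [t], where [P] is the
    projection onto the first eigenspace. *)
Definition two_valued P (s t : R) : 'B(H) := s ∙ P + t ∙ (1 - P).

Lemma two_valued_sa P s t : selfadjoint P -> selfadjoint (two_valued P s t).
Proof. by move=> sP; apply: saD; apply: saZ => //; exact: saB. Qed.

Lemma two_valued_spectrum P s t z : P * P = P ->
  spectrum (two_valued P s t) z -> z = s%:C \/ z = t%:C.
Proof.
move=> PP sz; apply: contrapT => /not_orP[zs zt]; apply: sz.
have s0 : s%:C - z != 0 by rewrite subr_eq0; apply/eqP => /esym.
have t0 : t%:C - z != 0 by rewrite subr_eq0; apply/eqP => /esym.
have PQ : P * (1 - P) = 0 by rewrite mulrBr mulr1 PP subrr.
have QP : (1 - P) * P = 0 by rewrite mulrBl mul1r PP subrr.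
have QQ : (1 - P) * (1 - P) = 1 - P by rewrite mulrBr mulr1 QP subr0.
have E : two_valued P s t - z *: idop H
    = (s%:C - z) *: P + (t%:C - z) *: (1 - P).
  rewrite -[idop H in LHS](subrKC P) scalerDr !scalerBl /two_valued.
  by rewrite opprD addrACA.
exists ((s%:C - z)^-1 *: P + (t%:C - z)^-1 *: (1 - P)).
have mulE A B : A ∘ B = A * B by [].
rewrite E !mulE -[idop H](subrKC P); split.
  rewrite mulrDl !mulrDr !scaleopAl !scaleopAr PP PQ QP QQ.
  by rewrite !scaler0 addr0 add0r !scalerA !mulfV// !scale1r.
rewrite mulrDl !mulrDr !scaleopAl !scaleopAr PP PQ QP QQ.
by rewrite !scaler0 addr0 add0r !scalerA !mulVf// !scale1r.
Qed.

Lemma polyop_widen (p : {poly R}) A n : (size p <= n)%N ->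
  polyop p A = \sum_(k < n) p`_k ∙ powop A k.
Proof.
move=> pn; rewrite /polyop (big_ord_widen n (fun k => p`_k ∙ powop A k))//.
rewrite big_mkcond/=; apply: eq_bigr => k _; case: ifP => // /negbT.
by rewrite -leqNgt => /(nth_default 0) ->; rewrite scale0r.
Qed.

Lemma polyop_affine A (a b : R) :
  polyop (a%:P + b *: 'X) A = a ∙ I + b ∙ A.
Proof.
rewrite (@polyop_widen _ _ 2); last first.
  rewrite (leq_trans (size_polyD _ _))// geq_max (leq_trans (size_polyC_leq1 _))//.
  by rewrite (leq_trans (size_scale_leq _ _))// size_polyX.
rewrite !big_ord_recl big_ord0 addr0 !coefD !coefZ !coefC !coefX/=.
rewrite mulr0 mulr1 addr0 add0r; congr (_ + _ *: _).
exact: mulr1.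
Qed.

(** On a spectrum of at most two points, [f] is an affine function. *)
Lemma two_valued_fun_calculus P s t f : P * P = P ->
  is_fun_calculus f (two_valued P s t) (two_valued P (f s) (f t)).
Proof.
move=> PP e e0; pose b := (f s - f t) / (s - t); pose a := f s - b * s.
have fs : a + b * s = f s by rewrite /a subrK.
have ft : a + b * t = f t.
  rewrite /a /b; have [->|st] := eqVneq s t; first by rewrite subrr mul0r; ring.
  by field; rewrite subr_eq0.
exists (a%:P + b *: 'X); split=> [u us|x].
  have -> : (a%:P + b *: 'X).[u] = f u.
    rewrite !hornerE; case: (two_valued_spectrum PP us) => /complexI ->//.
  by rewrite subrr normr0 ltW.
rewrite polyop_affine (_ : _ - _ = 0).
  by rewrite normr0 mulr_ge0// ler0c ltW.
apply/eqP; rewrite subr_eq0 -fs -ft /two_valued; apply/eqP.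
have : I = P + (I - P) by rewrite subrKC.
move: (I - P) => Q ->.
rewrite !scalerDr !scalerA !rmorphD !rmorphM/= !scalerDl.
by rewrite addrACA.
Qed.

Lemma operator_monotone_two_valued f P1 P2 s1 t1 s2 t2 : operator_monotone f ->
  selfadjoint P1 -> selfadjoint P2 -> P1 * P1 = P1 -> P2 * P2 = P2 ->
  0 < s1 -> 0 < t1 -> 0 < s2 -> 0 < t2 ->
  two_valued P1 s1 t1 <=op two_valued P2 s2 t2 ->
  two_valued P1 (f s1) (f t1) <=op two_valued P2 (f s2) (f t2).
Proof.
move=> [_ fmon] sP1 sP2 PP1 PP2 s10 t10 s20 t20; apply: fmon.
- exact: two_valued_sa.
- exact: two_valued_sa.
- by move=> z /(two_valued_spectrum PP2)[->|->]; [exists s2|exists t2].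
- by move=> z /(two_valued_spectrum PP1)[->|->]; [exists s1|exists t1].
- exact: two_valued_fun_calculus.
- exact: two_valued_fun_calculus.
Qed.

(** The off-diagonal part of [T] with respect to the unit vector [e] is absorbed by
    [2 Re <T x, y> <= r <T x, x> + <T y, y> / r], at the price of an arbitrarily
    small increase of the entry at [e] and a large entry on the complement. *)
Lemma diagonal_bound T e (d : R) : posop T -> ⟪ e, e ⟫ = 1 -> 0 < q T e -> 0 < d ->
  exists2 L, 0 < L & T <=op two_valued (rank1 e) (q T e + d) L.
Proof.
move=> pT e1 p0 d0; have sT := posop_sa pT; set p := q T e in p0 *.
pose r := d / p; have r0 : 0 < r by rewrite divr_gt0.
have [M M0 TM] := q_ub T.
exists ((1 + r^-1) * M + 1); first by rewrite ltr_wpDl// mulr_ge0// addr_ge0// invr_ge0 ltW.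
set P := rank1 e; have PP : P * P = P by exact: rank1_idem.
have sP : selfadjoint P by exact: rank1_sa.
apply: leopP => //; first exact: two_valued_sa.
move=> x; rewrite /two_valued !qE.
pose y := (1 - P) x.
have xE : x = P x + (1%:C : R[i]) *: y.
  by rewrite scale1r /y -addopE subrKC.
have qP : q P x = nrm (P x) ^+ 2 by rewrite -[in LHS]PP q_sqr.
have qQ : nrm x ^+ 2 - q P x = nrm y ^+ 2.
  rewrite -q_sqr; last by apply: saB.
  by rewrite mulrBr mulr1 mulrBl mul1r PP subrr subr0 !qE.
rewrite qQ qP.
have TP : q T (P x) = p * nrm (P x) ^+ 2.
  rewrite rank1E qZl -/p mulrC; congr (_ * _).
  have := nrm_sqr (⟪ x, e ⟫ *: e); rewrite innerZl innerZr e1 mulr1 => ->.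
  by [].
have h1 := q_line (P x) y 1 sT.
have h2 : 0 <= q T (y + (- r)%:C *: P x) by exact: posop_q.
rewrite q_line// in h2.
have ReC : complex.Re ⟪ T y, P x ⟫ = complex.Re ⟪ T (P x), y ⟫.
  by rewrite innerC sT; case: ⟪ _, _ ⟫.
have -> : q T x = q T (P x + (1%:C : R[i]) *: y) by rewrite -xE.
rewrite h1.
rewrite ReC TP in h2; rewrite TP.
have h3 := TM y; have h4 := sqr_ge0 (nrm y).
have rp : r * p = d by rewrite /r divfK// gt_eqF.
move: h2 h3 h4; move: (complex.Re _) (q T y) (nrm y ^+ 2) (nrm (P x) ^+ 2) => u v z t.
rewrite expr1n mul1r mulr1 => h2 h3 h4.
have h5 : 2 * u <= r^-1 * v + d * t.
  have -> : r^-1 * v + d * t = r^-1 * (v + r ^+ 2 * (p * t)).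
    by rewrite -rp; field; rewrite gt_eqF.
  by rewrite ler_pdivlMl//; lra.
have h6 : r^-1 * v <= r^-1 * (M * z) by rewrite ler_wpM2l// invr_ge0 ltW.
have -> : ((1 + r^-1) * M + 1) * z = M * z + r^-1 * (M * z) + z by ring.
by lra.
Qed.

End RankOne.

Section Concavity.
Context {R : realType}.

Lemma exists_two_unit_vectors (u v : R) : u ^+ 2 + v ^+ 2 = 1 ->
  exists (H : hilbertType R) (e w : H),
    [/\ ⟪ e, e ⟫ = 1, ⟪ w, w ⟫ = 1 & ⟪ e, w ⟫ = u%:C].
Proof.
move=> uv1; exists (ell2 R 2).
exists (\row_j (if j == 0 then 1 else 0)), (\row_j (if j == 0 then u%:C else v%:C)).
have E (x y : ell2 R 2) : ⟪ x, y ⟫ = x 0 0 * conjc (y 0 0) + x 0 1 * conjc (y 0 1).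
  rewrite [LHS]/(ell2_dot x y) /ell2_dot !big_ord_recl big_ord0 addr0.
  by congr (_ + x 0 _ * conjc (y 0 _)); exact: val_inj.
have cE (x y : R[i]) : complex.Re x = complex.Re y -> complex.Im x = complex.Im y -> x = y.
  by move=> h1 h2; apply/eqP; rewrite eq_complex h1 h2 !eqxx.
rewrite !E !mxE/=; split; apply: cE => /=; try ring.
by rewrite -uv1; ring.
Qed.

(** The entry at [e] of the operator [T] with eigenvalues [s] and [t], on the line
    of [w] and its complement, is the mean [p] of [s] and [t] with weight
    [|<e, w>|^2], and the entry at [e] of [f T] is that mean of [f s] and [f t].
    As [T] is below an operator that is diagonal with respect to [e] and has there
    an eigenvalue close to [p], monotonicity bounds the latter mean by [f p]. *)
Lemma operator_monotone_concave (f : R -> R) (s t a b : R) : operator_monotone f ->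
  0 < s -> 0 < t -> 0 <= a -> 0 <= b -> a + b = 1 ->
  a * f s + b * f t <= f (a * s + b * t).
Proof.
move=> fmon s0 t0 a0 b0 ab1.
set p := a * s + b * t.
have p0 : 0 < p.
  rewrite /p; have [a00|a1] := eqVneq a 0.
    by rewrite a00 mul0r add0r mulr_gt0//; lra.
  by apply: ltr_pwDl; [rewrite mulr_gt0// lt0r a1|rewrite mulr_ge0// ltW].
have [H [e [w [e1 w1 ew]]]] : exists (H : hilbertType R) (e w : H),
    [/\ ⟪ e, e ⟫ = 1, ⟪ w, w ⟫ = 1 & ⟪ e, w ⟫ = (Num.sqrt a)%:C].
  by apply: (@exists_two_unit_vectors _ (Num.sqrt b)); rewrite !sqr_sqrtr.
have qw (x y : R) : q (two_valued (rank1 w) x y) e = a * x + b * y.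
  rewrite /two_valued !qE /q rank1E innerZl ew.
  have -> : ⟪ w, e ⟫ = (Num.sqrt a)%:C by rewrite innerC ew conjc_real.
  have := nrm_sqr e; rewrite e1 => /complexI <-.
  rewrite -rmorphM/= -expr2 sqr_sqrtr//.
  by rewrite (_ : 1 - a = b) 1?mulrC 1?[b * _]mulrC//; lra.
have qe (x y : R) : q (two_valued (rank1 e) x y) e = x.
  rewrite /two_valued !qE /q rank1E innerZl !e1.
  have := nrm_sqr e; rewrite e1 => /complexI <-.
  by rewrite mulr1 /= mulr1 subrr mulr0 addr0.
pose T := two_valued (rank1 w) s t.
have pT : posop T.
  have pP : posop (rank1 w).
    by rewrite -(rank1_idem w1); apply: posop_sqr; exact: rank1_sa.
  have pQ : posop (1 - rank1 w).
    have <- : (1 - rank1 w) * (1 - rank1 w) = 1 - rank1 w.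
      by rewrite mulrBr mulr1 mulrBl mul1r (rank1_idem w1) subrr subr0.
    by apply/posop_sqr/saB => //; exact: rank1_sa.
  apply/posopE; split; first by apply: two_valued_sa; exact: rank1_sa.
  move=> x; rewrite /T /two_valued qD !(qZ s) (qZ t).
  by rewrite addr_ge0// mulr_ge0 ?(ltW s0) ?(ltW t0)//; exact: posop_q.
have step d : 0 < d -> a * f s + b * f t <= f (p + d).
  move=> d0; have [|L L0 TL] := diagonal_bound pT e1 _ d0; first by rewrite qw.
  rewrite qw -/p in TL.
  have pd0 : 0 < p + d by rewrite addr_gt0.
  have := operator_monotone_two_valued fmon (rank1_sa w) (rank1_sa e)
    (rank1_idem w1) (rank1_idem e1) s0 t0 pd0 L0 TL.
  by move/(leop_q e); rewrite qw qe.
have fc : f x @[x --> p] --> f p by have [fc _] := fmon; exact: fc.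
apply/ler_addgt0Pr => eps eps0.
move/cvgrPdist_le : fc => /(_ _ eps0) [d /= d0 hd].
have := hd (p + d / 2); rewrite /ball_ /= opprD addNKr normrN.
rewrite ger0_norm; last by rewrite ltW// divr_gt0.
rewrite ltr_pdivrMr// ltr_pMr// ltr1n => /(_ isT).
rewrite ler_norml => /andP[h _].
have := @step (d / 2) (divr_gt0 d0 (ltr0Sn _ _)); lra.
Qed.

Lemma operator_monotone_le (f : R -> R) (s t : R) : operator_monotone f ->
  0 < s -> s <= t -> f s <= f t.
Proof.
move=> fmon s0 st; have t0 : 0 < t by exact: lt_le_trans st.
have [|H [e [_ [e1 _ _]]]] := @exists_two_unit_vectors 1 0.
  by rewrite expr1n expr0n addr0.
have qe (x : R) : q (two_valued (rank1 e) x x) e = x.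
  rewrite /two_valued -scalerDr subrKC !qE.
  by have := nrm_sqr e; rewrite e1 => /complexI <-; rewrite mulr1.
have sP := rank1_sa e; have PP := rank1_idem e1.
have : two_valued (rank1 e) s s <=op two_valued (rank1 e) t t.
  apply: leopP; [exact: two_valued_sa|exact: two_valued_sa|move=> x].
  by rewrite /two_valued -!scalerDr subrKC !qE ler_wpM2r ?sqr_ge0.
move/(operator_monotone_two_valued fmon sP sP PP PP s0 s0 t0 t0)/(leop_q e).
by rewrite !qe.
Qed.

(** Concavity between [e] and [M], where [f e > 0] and [e] tends to [0]. *)
Lemma operator_monotone_starshaped (f : R -> R) (m M : R) : operator_monotone f ->
  (forall t, 0 < t -> 0 < f t) -> 0 < m -> m < M -> m * f M <= M * f m.
Proof.
move=> fmon fpos m0 mM.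
apply: (@le_of_le_addZ _ _ _ (f M - f m)) => e e0.
have fmM := operator_monotone_le fmon m0 (ltW mM).
have fm := fpos _ m0.
have [me|em] := leP m e; first by nra.
have Me : 0 < M - e by lra.
have w1 : 0 <= (M - m) / (M - e) by apply: divr_ge0; lra.
have w2 : 0 <= (m - e) / (M - e) by apply: divr_ge0; lra.
have w12 : (M - m) / (M - e) + (m - e) / (M - e) = 1 by field; lra.
have M0 : 0 < M by lra.
have h := operator_monotone_concave fmon e0 M0 w1 w2 w12.
have wm : (M - m) / (M - e) * e + (m - e) / (M - e) * M = m by field; lra.
rewrite wm in h.
have fe := fpos _ e0.
have : (m - e) / (M - e) * f M <= f m.
  apply: le_trans h; rewrite lerDr mulr_ge0 ?(ltW fe)// divr_ge0//; lra.
rewrite mulrAC ler_pdivrMr//; lra.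
Qed.

Lemma operator_monotone_chord (f : R -> R) (m M t : R) : operator_monotone f ->
  0 < m -> m < M -> m <= t -> t <= M ->
  (M * f m - m * f M) / (M - m) + (f M - f m) / (M - m) * t <= f t.
Proof.
move=> fmon m0 mM mt tM; have Mm : 0 < M - m by lra.
have w1 : 0 <= (M - t) / (M - m) by apply: divr_ge0; lra.
have w2 : 0 <= (t - m) / (M - m) by apply: divr_ge0; lra.
have w12 : (M - t) / (M - m) + (t - m) / (M - m) = 1 by field; lra.
have M0 : 0 < M by lra.
have := operator_monotone_concave fmon m0 M0 w1 w2 w12.
have -> : (M - t) / (M - m) * m + (t - m) / (M - m) * M = t by field; lra.
apply: le_trans; rewrite le_eqVlt; apply/orP; left; apply/eqP; field; lra.
Qed.

End Concavity.

(** * The geometric mean and the main inequality *)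

Section GeometricMean.
Context {R : realType}.

Lemma young_powR (omega alpha t : R) : 0 <= omega -> 0 < alpha -> alpha < 1 ->
  0 < t -> omega `^ (1 - alpha) * t `^ alpha <= (1 - alpha) * omega + alpha * t.
Proof.
move=> w0 a0 a1 t0; have b0 : 0 < 1 - alpha by lra.
have := @conjugate_powR _ (omega `^ (1 - alpha)) (t `^ alpha) (1 - alpha)^-1 alpha^-1
  (powR_ge0 _ _) (powR_ge0 _ _).
rewrite !invrK !invr_gt0 -!powRrM !divff ?gt_eqF// !powRr1 ?(ltW t0)//.
rewrite (mulrC omega) (mulrC t); apply => //; lra.
Qed.

Variables (K : hilbertType R).
Local Notation I := (1 : 'B(K)).
Implicit Types X Y : 'B(K).

(** Young's inequality is divided by [omega^(1 - alpha)] to obtain an affine bound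
    for [t^alpha], whence the separate case [omega = 0]. *)
Lemma geometric_le_arithmetic alpha (geo : 'B(K) -> 'B(K) -> 'B(K)) (omega : R) X Y (e : R) :
  geometric_mean alpha geo -> 0 < alpha -> alpha < 1 -> 0 <= omega ->
  posop X -> posop Y -> 0 < e ->
  omega `^ (1 - alpha) ∙ geo (X + e ∙ I) (Y + e ∙ I)
    <=op ((1 - alpha) * omega) ∙ (X + e ∙ I) + alpha ∙ (Y + e ∙ I).
Proof.
move=> [hgeo hpow] a0 a1 w0 pX pY e0.
have eX := ge_addr e pX; have eY := ge_addr e pY.
set X' := X + _ in eX *; set Y' := Y + _ in eY *.
have sX := sa_of_ge eX; have sY := sa_of_ge eY.
have pX' := sposop_ge e0 eX; have pY' := sposop_ge e0 eY.
clearbody X' Y'.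
have posS A : sposop A -> posop A.
  move=> [sA pA]; split=> // x; have [->|x0] := eqVneq x 0; last exact/ltW/pA.
  by rewrite inner0r.
move: w0; rewrite le_eqVlt => /predU1P[<-|w0].
  rewrite powR0; last by apply/eqP; lra.
  rewrite scale0r mulr0 scale0r add0r /leop subr0.
  apply/posopE; split; first exact: saZ.
  by move=> x; rewrite qZ mulr_ge0 ?(ltW a0)// posop_q//; exact: posS.
have [MX MX0 XM] := q_ub X'; have [MY MY0 YM] := q_ub Y'.
pose c := MX + MY + e.
have c0 : 0 < c by rewrite /c; lra.
have Xc x : q X' x <= c * nrm x ^+ 2.
  by rewrite (le_trans (XM x))// ler_wpM2r ?sqr_ge0// /c; lra.
have Yc x : q Y' x <= c * nrm x ^+ 2.
  by rewrite (le_trans (YM x))// ler_wpM2r ?sqr_ge0// /c; lra.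
have ec : e / c <= 1 by rewrite ler_pdivrMr// mul1r /c; lra.
have ce : 1 <= c / e by rewrite ler_pdivlMr// mul1r /c; lra.
have mX : (e / c) ∙ X' <=op Y'.
  apply: leopP => //; first exact: saZ.
  move=> x; have := leop_q x eY; rewrite !qE; apply: le_trans.
  rewrite mulrAC ler_pdivrMr// -mulrA ler_pM2l// [leRHS]mulrC; exact: Xc.
have XM' : Y' <=op (c / e) ∙ X'.
  apply: leopP => //; first exact: saZ.
  move=> x; rewrite !qE (le_trans (Yc x))// -mulrA ler_pM2l//.
  by rewrite ler_pdivlMl//; have := leop_q x eX; rewrite !qE.
have g0 : 0 < omega `^ (1 - alpha) by exact: powR_gt0.
have bound (t : R) : 0 < t -> t `^ alpha <=
    ((1 - alpha) * omega) / omega `^ (1 - alpha) + alpha / omega `^ (1 - alpha) * t.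
  move=> t0; rewrite (mulrAC alpha) -mulrDl ler_pdivlMr// mulrC.
  by apply: young_powR => //; exact: ltW.
have h := mean_le_line hgeo hpow e0 (divr_gt0 e0 c0) (le_trans ec ce) eX mX XM'
   (divr_ge0 (ltW a0) (ltW g0)) bound.
have sG : selfadjoint (geo X' Y') by case: (mean_pos hgeo pX' pY').
apply: leopP; [exact: saZ|by apply: saD; exact: saZ|move=> x].
have := leop_q x h; rewrite !qE => /(ler_wpM2l (ltW g0)) /le_trans; apply.
rewrite le_eqVlt; apply/orP; left; apply/eqP; field; rewrite gt_eqF//.
Qed.

(** When the limit defining the extended mean does not exist, its value is [0]
    and the inequality holds trivially. *)
Lemma ext_geometric_le_arithmetic alpha geo (omega : R) X Y :
  geometric_mean alpha geo -> 0 < alpha -> alpha < 1 -> 0 <= omega ->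
  posop X -> posop Y ->
  omega `^ (1 - alpha) ∙ ext_mean geo X Y <=op warith alpha (omega ∙ X) Y.
Proof.
move=> hgeo a0 a1 w0 pX pY.
pose W := ((1 - alpha) * omega) ∙ X + alpha ∙ Y.
have -> : warith alpha (omega ∙ X) Y = W by rewrite /warith scalerA -rmorphM.
rewrite /ext_mean; case: xgetP => [L _ hL|_].
  have hL' x : geo (X + e ∙ I) (Y + e ∙ I) x @[e --> (0 : R)^'+] --> L x by exact: hL.
  pose s := (1 - alpha) * omega + alpha.
  pose Z (e : R) := (W + (e * s) ∙ I) - omega `^ (1 - alpha) ∙ geo (X + e ∙ I) (Y + e ∙ I).
  apply: (@posop_lim _ _ _ (0 : R)^'+ _ Z) => [x|].
    apply: cvgB; last by apply: cvgZl_tmp; exact: hL'.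
    suff h : ((e * s) ∙ I) x @[e --> (0 : R)^'+] --> (0 : K).
      have := cvgD (cvg_cst (W x)) h; rewrite addr0 => h'; exact: (h' _ _).
    apply: nrm_cvg => eps eps0.
    have d0 : 0 < eps / (`|s| * nrm x + 1).
      by rewrite divr_gt0// ltr_wpDl// mulr_ge0 ?nrm_ge0.
    near=> e; rewrite subr0 scaleopE nrmZ normrM -mulrA.
    have e0 : 0 < e by near: e; exact: nbhs_right_gt.
    have ed : e < eps / (`|s| * nrm x + 1) by near: e; exact: nbhs_right_lt.
    rewrite gtr0_norm//; move: ed; rewrite ltr_pdivlMr; last first.
      by rewrite ltr_wpDl// mulr_ge0 ?nrm_ge0.
    by rewrite mulrDr mulr1 oneopE; lra.
  near=> e; have e0 : 0 < e by near: e; exact: nbhs_right_gt.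
  have := geometric_le_arithmetic hgeo a0 a1 w0 pX pY e0.
  rewrite /leop /Z; congr (posop (_ - _)).
  rewrite !scalerDr !scalerA -!rmorphM/= addrACA -scalerDl -rmorphD/= -/W.
  by rewrite -mulrDl -/s mulrC.
rewrite scaler0 /leop subr0.
have sX := posop_sa pX; have sY := posop_sa pY.
apply/posopE; split; first by apply: saD; exact: saZ.
move=> x; rewrite !qE addr_ge0// mulr_ge0 ?posop_q ?(ltW a0)// mulr_ge0//.
by rewrite subr_ge0 ltW.
Unshelve. all: by end_near. Qed.

End GeometricMean.

Theorem theorem2p1 (R : realType) (H K : hilbertType R)
    (A B : 'B(H)) (a1 a2 b1 b2 : R)
    (hb1 : 0 < b1) (hba1 : b1 < a1) (hb2 : 0 < b2) (hba2 : b2 < a2)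
    (hA : realop b1 <=op A /\ A <=op realop a1)
    (hB : realop b2 <=op B /\ B <=op realop a2)
    (Phi : {linear 'B(H) -> 'B(K)}) (hPhi : positive_map Phi)
    (sigma : 'B(H) -> 'B(H) -> 'B(H)) (f : R -> R)
    (hsigma : operator_mean sigma) (hf : representing_function sigma f)
    (alpha : R) (halpha0 : 0 < alpha) (halpha1 : alpha < 1)
    (geo : 'B(K) -> 'B(K) -> 'B(K)) (hgeo : geometric_mean alpha geo) :
  let mu := a1 * b1 * (f (b2 * a1^-1) - f (a2 * b1^-1))
              / (b1 * b2 - a1 * a2) in
  let nu := (a1 * a2 * f (b2 * a1^-1) - b1 * b2 * f (a2 * b1^-1))
              / (a1 * a2 - b1 * b2) in
  let omega := alpha * nu / ((1 - alpha) * mu) in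
  mu != 0 ->
  (omega `^ (1 - alpha))%:C *: ext_mean geo (Phi A) (Phi B)
    <=op warith alpha (omega%:C *: Phi A) (Phi B) /\
  warith alpha (omega%:C *: Phi A) (Phi B)
    <=op (alpha / mu)%:C *: Phi (sigma A B).
Proof.
move=> mu nu omega mu_neq0.
have a10 : 0 < a1 by lra.
have a20 : 0 < a2 by lra.
pose m := b2 / a1; pose M := a2 / b1.
have m0 : 0 < m by rewrite divr_gt0.
have bb : b1 * b2 < a1 * a2 by apply: ltr_pM => //; exact: ltW.
have mM : m < M by rewrite /m /M ltr_pdivrMr// mulrAC ltr_pdivlMr// mulrC (mulrC a2).
have Mm : 0 < M - m by lra.
have fmon := repr_monotone hf; have fpos := repr_pos hf.
have muE : mu = (f M - f m) / (M - m).
  rewrite /mu -/m -/M; move: (f m) (f M) => u v; rewrite /M /m.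
  by field; apply/and4P; split;
    [exact: lt0r_neq0|exact: lt0r_neq0|rewrite gt_eqF//; lra|rewrite lt_eqF//; lra].
have nuE : nu = (M * f m - m * f M) / (M - m).
  rewrite /nu -/m -/M; move: (f m) (f M) => u v; rewrite /M /m.
  by field; apply/and3P; split; rewrite gt_eqF//; lra.
have mu0 : 0 < mu.
  rewrite lt0r mu_neq0 muE divr_ge0 ?(ltW Mm)// subr_ge0.
  exact: operator_monotone_le (ltW mM).
have nu0 : 0 <= nu.
  rewrite nuE divr_ge0 ?(ltW Mm)// subr_ge0.
  exact: operator_monotone_starshaped.
have omega0 : 0 <= omega.
  by apply: divr_ge0; apply: mulr_ge0 => //; lra.
have chord t : m <= t -> t <= M -> nu + mu * t <= f t.
  by rewrite muE nuE; exact: operator_monotone_chord.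
have [bA Aa] := hA; have [bB Ba] := hB.
have sA := sa_of_ge bA; have sB := sa_of_ge bB.
have mAB : m ∙ A <=op B.
  apply: leopP => //; first exact: saZ.
  move=> x; have := leop_q x bB; have := leop_q x Aa; rewrite !realopE !qE => h1.
  apply: le_trans; rewrite /m mulrAC ler_pdivrMr// -mulrA ler_pM2l// [leRHS]mulrC.
  exact: h1.
have BMA : B <=op M ∙ A.
  apply: leopP => //; first exact: saZ.
  move=> x; have := leop_q x Ba; have := leop_q x bA; rewrite !realopE !qE => h1 h2.
  rewrite (le_trans h2)// /M -mulrA ler_pM2l// ler_pdivlMl//.
have pos A' e : 0 < e -> selfadjoint A' -> realop e <=op A' -> posop A'.
  move=> e0 sA' eA; apply/posopE; split=> // x; have := leop_q x eA.
  by rewrite realopE !qE; apply: le_trans; rewrite mulr_ge0 ?sqr_ge0// ltW.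
split.
  apply: ext_geometric_le_arithmetic => //; apply: hPhi.
  - exact: pos hb1 sA bA.
  - exact: pos hb2 sB bB.
have h := hPhi _ (mean_ge_line hsigma hf hb1 m0 (ltW mM) bA mAB BMA (ltW mu0) chord).
have -> : warith alpha (omega ∙ Phi A) (Phi B) = (alpha / mu) ∙ Phi (nu ∙ A + mu ∙ B).
  rewrite /warith linearD !linearZ/= scalerDr !scalerA -!rmorphM/=.
  by congr (_%:C *: _ + _%:C *: _); rewrite /omega; field; rewrite gt_eqF//=; lra.
rewrite /leop -scalerBr -linearB.
apply/posopE; split; first exact/saZ/posop_sa.
by move=> x; rewrite qZ mulr_ge0 ?posop_q// divr_ge0// ltW.
Qed.
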